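(* Let $\{F_\mu:\mu\in\mathcal{M}\}$, $\mathcal{M}\subseteq\mathbb{R}$, be a family of probability distributions on $\mathcal{Y}$ with densities $f_\mu$ with respect to a common dominating measure $\nu$. Let $\mu_1,\mu_2,\dots\in\mathcal{M}$, let $Y_1,Y_2,\dots$ be independent with $Y_i\sim F_{\mu_i}$, and write $f_i=f_{\mu_i}$. For each $n$ put $$p_j(Y_i)=\frac{f_j(Y_i)}{\sum_{k=1}^n f_k(Y_i)},\qquad i,j=1,\dots,n .$$ Suppose that there are constants $C<\infty$ and $\gamma>0$, not depending on $n$, such that for every $n$ both of the following hold. (G1) $\max_{1\le i\le n}|\mu_i|<C$; $\ \max_{1\le i,j\le n}\mathrm{E}_{\mu_i}\bigl(f_{\mu_j}(Y_1)/f_{\mu_i}(Y_1)\bigr)^2<C$; and $\min_{1\le i,j\le n}P_{\mu_i}\bigl(f_{\mu_j}(Y_1)/f_{\mu_i}(Y_1)>\gamma\bigr)\ge 1/2$. (G2) $$\mathrm{E}\sum_{i=1}^n\sum_{j=1}^n\bigl(p_j(Y_i)\bigr)^2<C,\qquad \sum_{i=1}^n\mathrm{E}\,\frac{1}{n\min_j p_j(Y_i)}<Cn,\qquad \mathrm{E}\sum_{i=1}^n\frac{\sum_{j=1}^n\bigl(p_j(Y_i)\bigr)^2}{n\min_j p_j(Y_i)}<C .$$ Let $\Delta^S_{\boldsymbol{\mu}}$ and $\Delta^{PI}_{\boldsymbol{\mu}}$ be the best simple symmetric and the best permutation invariant estimators of $\mu_{1:n}$, with total squared error risks $r^S_n$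 and $r^{PI}_n$. Then, as $n\to\infty$, (i) $\mathrm{E}\,\|\Delta^S_{\boldsymbol{\mu}}(Y_{1:n})-\Delta^{PI}_{\boldsymbol{\mu}}(Y_{1:n})\|^2=O(1)$; (ii) $r^S_n-r^{PI}_n=O(1)$.
   Context: For a sequence $x$, $x_{1:n}=(x_1,\dots,x_n)$, and $\|a_{1:n}\|^2=\sum_{i=1}^n a_i^2$. $\boldsymbol{\mu}=\boldsymbol{\mu}_n$ denotes the multiset $\{\mu_1,\dots,\mu_n\}$ (the values without order information). It is assumed known, and estimators may depend on it. The loss of an estimator $\hat\mu_{1:n}=\Delta(Y_{1:n})$ is $\sum_{i=1}^n(\hat\mu_i-\mu_i)^2$. $\mathrm{E}$ is expectation under the model where $Y_1,\dots,Y_n$ are independent and $Y_i\sim F_{\mu_i}$. $\mathrm{E}_{\mu_i}$ and $P_{\mu_i}$ are expectation and probability when the single observation $Y_1$ has distribution $F_{\mu_i}$. Simple symmetric rules: all $\Delta$ with $\Delta(Y_{1:n})=(\delta(Y_1),\dots,\delta(Y_n))$ for some real-valued measurable $\delta$ on $\mathcal{Y}$. $\Delta^S_{\boldsymbol{\mu}}$ is the minimizer of $\mathrm{E}\|\Delta(Y_{1:n})-\mu_{1:n}\|^2$ over this class, and $r^S_n=\mathrm{E}\|\Delta^S_{\boldsymbol{\mu}}(Y_{1:n})-\mu_{1:n}\|^2$. Permutation invariant rules: all real-vector-valued measurable $\Delta$ such that, for every permutation $\pi$ of $\{1,\dots,n\}$ and every $(Y_1,\dots,Y_n)$, $\Delta(Y_1,\dots,Y_n)=(\hat\mu_1,\dots,\hat\mu_n)$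 if and only if $\Delta(Y_{\pi(1)},\dots,Y_{\pi(n)})=(\hat\mu_{\pi(1)},\dots,\hat\mu_{\pi(n)})$. $\Delta^{PI}_{\boldsymbol{\mu}}$ is the minimizer of $\mathrm{E}\|\Delta(Y_{1:n})-\mu_{1:n}\|^2$ over this class, and $r^{PI}_n=\mathrm{E}\|\Delta^{PI}_{\boldsymbol{\mu}}(Y_{1:n})-\mu_{1:n}\|^2$. Equivalently, these rules are posterior means in the model in which $\pi$ is a uniformly distributed permutation of $\{1,\dots,n\}$ and, given $\pi$, the $Y_i$ are independent with $Y_i\sim F_{\mu_{\pi(i)}}$. Writing $M_i=\mu_{\pi(i)}$, the $i$-th coordinate of $\Delta^S_{\boldsymbol{\mu}}(Y_{1:n})$ is $E(M_i\mid Y_i)$ and the $i$-th coordinate of $\Delta^{PI}_{\boldsymbol{\mu}}(Y_{1:n})$ is $E(M_i\mid Y_{1:n})$. Explicitly, these are respectively $$\frac{\sum_{j=1}^n\mu_j f_{j}(Y_i)}{\sum_{j=1}^n f_{j}(Y_i)}\qquad\text{and}\qquad \frac{\sum_{\pi}\mu_{\pi(i)}\prod_{k=1}^n f_{\pi(k)}(Y_k)}{\sum_{\pi}\prod_{k=1}^n f_{\pi(k)}(Y_k)},$$ with sums over all permutations $\pi$ of $\{1,\dots,n\}$. *)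

(* Defs.v *)
From mathcomp Require Import all_boot all_order all_algebra perm.
From mathcomp Require Import all_classical all_reals all_analysis.
Import Order.TTheory GRing.Theory Num.Theory numFieldNormedType.Exports.

Set Implicit Arguments.
Unset Strict Implicit.
Unset Printing Implicit Defensive.

Local Open Scope classical_set_scope.
Local Open Scope ring_scope.

(* Sequences are indexed from 0: the mathematical x_1, ..., x_n are
   x 0, ..., x n.-1. *)
Definition prefix_tuple (T : Type) (x : nat -> T) (n : nat) : n.-tuple T :=
  [tuple x i | i < n].

Definition sqdist (R : realType) (n : nat) (a b : n.-tuple R) : R :=
  \sum_(i < n) (tnth a i - tnth b i) ^+ 2.

Definition permute (T : Type) (n : nat) (s : 'S_n) (y : n.-tuple T) :
  n.-tuple T := [tuple tnth y (s i) | i < n].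

Definition is_density (d : measure_display) (T : measurableType d)
    (R : realType) (nu : {measure set T -> \bar R}) (Q : probability T R)
    (g : T -> R) : Prop :=
  [/\ measurable_fun setT g,
      forall y, 0 <= g y
    & forall A, measurable A -> Q A = (\int[nu]_(y in A) (g y)%:E)%E].

Definition mutually_independent (d0 d : measure_display)
    (Omega : measurableType d0) (T : measurableType d) (R : realType)
    (P : probability Omega R) (Y : nat -> {RV P >-> T}) : Prop :=
  forall (J : seq nat) (A : nat -> set T),
    uniq J -> (forall i, measurable (A i)) ->
    P (\bigcap_(i in [set` J]) (Y i @^-1` A i)) =
    (\prod_(i <- J) P (Y i @^-1` A i))%E.

Section compound_decision.
Context {d : measure_display} {T : measurableType d} {R : realType}.

Definition simple_symmetric (n : nat) (D : n.-tuple T -> n.-tuple R) : Prop :=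
  exists2 delta : T -> R, measurable_fun setT delta &
    forall y, D y = map_tuple delta y.

Definition permutation_invariant (n : nat) (D : n.-tuple T -> n.-tuple R) :
    Prop :=
  measurable_fun setT D /\
  forall (s : 'S_n) (y : n.-tuple T) (m : n.-tuple R),
    D y = m <-> D (permute s y) = permute s m.

Definition risk (d0 : measure_display) (Omega : measurableType d0)
    (P : probability Omega R) (Y : nat -> {RV P >-> T}) (mu : nat -> R)
    (n : nat) (D : n.-tuple T -> n.-tuple R) : \bar R :=
  'E_P[fun w => sqdist (D (prefix_tuple (fun i => Y i w) n))
                       (prefix_tuple mu n)].

(* Minimizers are unique only almost surely, so "the" best rule of a class is
   rendered by a predicate. *)
Definition best_rule (d0 : measure_display) (Omega : measurableType d0)
    (P : probability Omega R) (Y : nat -> {RV P >-> T}) (mu : nat -> R)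
    (n : nat) (rules : (n.-tuple T -> n.-tuple R) -> Prop)
    (D : n.-tuple T -> n.-tuple R) : Prop :=
  rules D /\ forall D', rules D' -> (risk Y mu D <= risk Y mu D')%E.

(* The weight p_j(y) for the sample size n. The denominator vanishes only on
   a null set for each F_(mu_i) with i < n. *)
Definition weight (f : R -> T -> R) (mu : nat -> R) (n j : nat) (y : T) : R :=
  f (mu j) y / \sum_(k < n) f (mu k) y.

Definition min_weight (f : R -> T -> R) (mu : nat -> R) (n : nat) (y : T) :
    \bar R :=
  \big[Order.min/+oo%E]_(j < n) (weight f mu n j y)%:E.

Definition G1 (F : R -> probability T R) (f : R -> T -> R) (mu : nat -> R)
    (C gamma : R) (n : nat) : Prop :=
  [/\ forall i, (i < n)%N -> `|mu i| < C,
      forall i j, (i < n)%N -> (j < n)%N ->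
        ('E_(F (mu i))[fun y => ((f (mu j) y / f (mu i) y) ^+ 2)%R] < C%:E)%E
    & forall i j, (i < n)%N -> (j < n)%N ->
        ((2^-1)%:E <=
          F (mu i) [set y | (gamma < f (mu j) y / f (mu i) y)%R])%E].

(* The reciprocals are taken in \bar R, where 0^-1 = +oo; with the convention
   0^-1 = 0 of R, observations with min_j p_j(Y_i) = 0 would contribute
   nothing. *)
Definition G2 (d0 : measure_display) (Omega : measurableType d0)
    (P : probability Omega R) (Y : nat -> {RV P >-> T})
    (f : R -> T -> R) (mu : nat -> R) (C : R) (n : nat) : Prop :=
  [/\ ('E_P[fun w => (\sum_(i < n) \sum_(j < n)
              weight f mu n j (Y i w) ^+ 2)%R] < C%:E)%E,
      (\sum_(i < n) \int[P]_w (n%:R%:E * min_weight f mu n (Y i w))^-1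
         < C%:E * n%:R%:E)%E
    & (\int[P]_w \sum_(i < n)
         ((\sum_(j < n) weight f mu n j (Y i w) ^+ 2)%R%:E
           / (n%:R%:E * min_weight f mu n (Y i w)))
         < C%:E)%E].

End compound_decision.

(* Finiteness is required because fine sends infinite values to 0. *)
Definition ereal_bigO1 (R : realType) (u : nat -> \bar R) : Prop :=
  (\forall n \near \oo, u n \is a fin_num) /\
  (fun n => fine (u n) : R^o) =O_\oo (fun=> 1 : R^o).

(* Main.v *)
From HB Require Import structures.
Require Import Defs.
From mathcomp Require Import all_boot all_order all_algebra perm.
From mathcomp Require Import all_classical all_reals all_analysis.
From mathcomp Require Import measurable_realfun ring lra zify.
Import Order.TTheory GRing.Theory Num.Theory numFieldNormedType.Exports.

Set Implicit Arguments.
Unset Strict Implicit.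
Unset Printing Implicit Defensive.

Local Open Scope classical_set_scope.
Local Open Scope ring_scope.

(** Both assertions follow from a bound, uniform in n, on the gap between the
    two risks.  Permutation invariant rules form a convex set that contains
    the best simple symmetric rule S and the best invariant rule PI, so the
    midpoint of S and PI has risk at least that of PI; by the parallelogram
    identity E |S - PI|^2 is then at most twice the gap
    ([expected_sqdist_le_risk_gap]).  For the gap, S may be replaced by the
    simple rule s(u) = sum_j mu_j p_j(u), whose risk is no smaller.

    The gap is bounded by hiding only one transposition instead of a whole
    permutation.  Let D be permutation invariant.  The i-th coordinate of D at
    Y is its coordinate 0 at the sample in which Y_0 and Y_i are exchanged, and
    the law of the exchanged sample has density
    W_i = (f_i/f_0)(Y_0) (f_0/f_i)(Y_i) with respect to the law of Y
    ([integral_tperm_ord0]).  Hence the risk of D is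
    E sum_i W_i (D_0(Y) - mu_i)^2, in which all terms live on the same
    sample and the observations are independent; the same holds for s.
    For fixed Y the quadratic in D_0 is minimal at the weighted mean of the
    mu_i, so the risk of s exceeds that of D by at most
    E (sum_i W_i (s - mu_i))^2 / sum_i W_i ([weighted_sqr_le]).

    Put p_k = p_k(Y_0) and L_k = (f_0/f_k)(Y_k).  As sum_k p_k (s - mu_k) = 0,
    this excess equals the expectation of
      (sum_k p_k (s - mu_k) (L_k - 1))^2 / (p_0 sum_k p_k L_k).
    Given Y_0, the numerator is the square of a sum of independent centred
    variables, of size C^3 sum_k p_k^2, while the denominator is of order
    n p_0 min_k p_k, since each L_k exceeds gamma with probability at least
    1/2.  To make numerator and denominator independent, the indices are split
    into two halves A and B: the part of the sum over A is divided by a lower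
    bound of the denominator that involves B only, and conversely
    ([swap_weight_bound], [half_sample_bound]).  Both independent estimates are
    obtained by integrating out one coordinate at a time
    ([integral_inv_count], [integral_sqr_affine_sum]).  What is left is
    E_{F_0} of sum_k p_k^2 / (p_0 n min_k p_k), and as 1/p_0 = sum_i f_i/f_0
    this is sum_i E_{F_i} of sum_k p_k^2 / (n min_k p_k), the third
    quantity bounded in [G2]. *)

(** * Change of density *)

Lemma measurable_invr (R : realType) : measurable_fun [set: R] (@GRing.inv R).
Proof.
have -> : (@GRing.inv R : R -> R) = fun x => x * (x ^+ 2) `^ (- 1).
  apply/funext => x; rewrite powR_inv1 ?sqr_ge0//.
  have [->|x0] := eqVneq x 0; first by rewrite mul0r invr0.
  by rewrite expr2 invfM mulrA divff// mul1r.
apply: measurable_funM => //.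
apply: (@measurableT_comp _ _ _ _ _ _ (fun x : R => x `^ (- 1))) => //.
Qed.

Lemma measurable_fun_invr d (T : measurableType d) (R : realType) (D : set T)
    (f : T -> R) :
  measurable_fun D f -> measurable_fun D (fun x => (f x)^-1).
Proof. by move=> mf; exact: (measurableT_comp (@measurable_invr R)). Qed.

Section densities.
Local Open Scope ereal_scope.
Context {d : measure_display} {T : measurableType d} {R : realType}.
Variable nu : {measure set T -> \bar R}.
Import HBNNSimple.

(** The dominating measure is arbitrary, possibly not sigma-finite, so the
    formula is obtained directly by monotone approximation with simple
    functions. *)
Lemma integral_density (Q : probability T R) (g : T -> R) (h : T -> \bar R) :
  is_density nu Q g -> measurable_fun setT h -> (forall y, 0 <= h y) ->
  \int[Q]_y h y = \int[nu]_y (h y * (g y)%:E).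
Proof.
move=> [mg g0 Qg] mh h0.
pose u := nnsfun_approx measurableT mh.
have uh x : (EFin \o u ^~ x) @ \oo --> h x.
  by apply: cvg_nnsfun_approx => // y _; exact: h0.
have mge : measurable_fun setT (fun x => (g x)%:E) by exact/measurable_EFinP.
have mu_ k : measurable_fun setT (fun x => (u k x)%:E).
  by apply/measurable_EFinP; exact: measurable_funP.
transitivity (limn (fun k => \int[Q]_y (u k y)%:E)).
  rewrite -monotone_convergence//.
  - by apply: eq_integral => x _; apply/esym; exact: (cvg_lim _ (uh x)).
  - by move=> k x _; rewrite lee_fin.
  - by move=> x _ a b ab; rewrite lee_fin; exact/lefP/nd_nnsfun_approx.
transitivity (limn (fun k => \int[nu]_y ((u k y)%:E * (g y)%:E))); last first.
  rewrite -monotone_convergence//.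
  - apply: eq_integral => x _; apply/cvg_lim => //.
    by apply: cvgeZr => //; exact: uh.
  - by move=> k; exact: emeasurable_funM.
  - by move=> k x _; rewrite mule_ge0 ?lee_fin.
  - move=> x _ a b ab; rewrite lee_wpmul2r ?lee_fin//.
    exact/lefP/nd_nnsfun_approx.
congr (limn _); apply/funext => k.
have mi r : measurable_fun setT (fun x => (r * \1_(u k @^-1` [set r]) x)%:E).
  by apply/measurable_EFinP; exact: measurable_funM.
transitivity (\int[Q]_y (\sum_(r \in range (u k))
   (r * \1_(u k @^-1` [set r]) y)%:E)).
  by apply: eq_integral => t tE; rewrite /= fimfunE -fsumEFin.
rewrite ge0_integral_fsum//; last by move=> m y Ey; exact: nnfun_muleindic_ge0.
transitivity (\int[nu]_y (\sum_(r \in range (u k))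
   (r * \1_(u k @^-1` [set r]) y)%:E * (g y)%:E)); last first.
  apply: eq_integral => x _.
  rewrite -ge0_mule_fsuml => [|y]; last exact: nnfun_muleindic_ge0.
  by rewrite fsumEFin // -(fimfunE _ x).
rewrite ge0_integral_fsum//; last 2 first.
  - by move=> y; exact: emeasurable_funM.
  - move=> m y Ey; apply: mule_ge0; last by rewrite lee_fin.
    exact: nnfun_muleindic_ge0.
apply: eq_fsbigr => r /set_mem [x _ <-{r}]; set r := u k x.
have mS : measurable (u k @^-1` [set r]) by exact: measurable_sfunP.
under eq_integral do rewrite EFinM.
under [RHS]eq_integral do rewrite EFinM -muleA.
have m1 : measurable_fun setT (fun y => (\1_(u k @^-1` [set r]) y)%:E : \bar R).
  exact/measurable_EFinP.
rewrite ge0_integralZl// ?lee_fin//.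
rewrite ge0_integralZl// ?lee_fin//; last 2 first.
- exact: emeasurable_funM.
- by move=> y _; rewrite mule_ge0// lee_fin.
congr (_ * _); rewrite integral_indic// setIT.
transitivity (\int[nu]_(y in u k @^-1` [set r]) (g y)%:E); first exact: Qg.
rewrite integral_mkcond.
by apply: eq_integral => y _; rewrite epatch_indic muleC.
Qed.

(** Moving from one member of the family to another no longer mentions the
    dominating measure: from here on all integrals are with respect to
    probabilities. *)
Lemma integral_density_ratio (Q1 Q2 : probability T R) (g1 g2 : T -> R)
    (h : T -> \bar R) :
  is_density nu Q1 g1 -> is_density nu Q2 g2 -> {ae Q2, forall y, 0 < g1 y}%R ->
  measurable_fun setT h -> (forall y, 0 <= h y) ->
  \int[Q1]_y (h y * (g2 y / g1 y)%:E) = \int[Q2]_y h y.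
Proof.
move=> D1 D2 g1p mh h0; have [mg1 g10 Q1g] := D1; have [mg2 g20 Q2g] := D2.
have mr : measurable_fun setT (fun y => (g2 y / g1 y)%:E).
  apply/measurable_EFinP; apply: measurable_funM => //.
  exact: measurable_fun_invr.
have mpos : measurable_fun setT (fun y => (\1_[set y | (0 < g1 y)%R] y)%:E : \bar R).
  apply/measurable_EFinP; apply: measurable_indic.
  rewrite -[X in measurable X]setTI (_ : mkset _ = g1 @^-1` `]0%R, +oo[).
    exact: mg1.
  by apply/seteqP; split => y /=; rewrite in_itv/= andbT.
rewrite (integral_density D1); last 2 first.
- exact: emeasurable_funM.
- by move=> y; rewrite mule_ge0// lee_fin divr_ge0.
transitivity (\int[Q2]_y (h y * (\1_[set y | (0 < g1 y)%R] y)%:E)); last first.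
  apply: ge0_ae_eq_integral => //; first exact: emeasurable_funM.
    by move=> y _; rewrite mule_ge0// lee_fin.
  apply: filterS g1p => y yp _.
  by rewrite indicE mem_set ?mule1.
rewrite (integral_density D2); last 2 first.
- exact: emeasurable_funM.
- by move=> y; rewrite mule_ge0// lee_fin.
apply: eq_integral => y _; rewrite -!muleA -!EFinM indicE; congr (_ * _%:E).
have := g10 y; rewrite le_eqVlt => /predU1P[/esym gy|yp].
  by rewrite memNset/= gy ?ltxx// invr0 !mulr0 mul0r.
by rewrite mem_set// mul1r divfK// gt_eqF.
Qed.

End densities.

(** * Product laws on tuples and resampling of one coordinate *)

Section product_law.
Context {d : measure_display} {T : measurableType d} {R : realType} {n : nat}.
Implicit Types (y : n.-tuple T) (i j : 'I_n) (h : n.-tuple T -> \bar R).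

Definition update y i (u : T) : n.-tuple T :=
  [tuple if j == i then u else tnth y j | j < n].

Definition box (A : 'I_n -> set T) : set (n.-tuple T) :=
  [set y | forall i, A i (tnth y i)].

Definition product_law (Q : probability (n.-tuple T) R)
    (G : 'I_n -> probability T R) : Prop :=
  forall A, (forall i, measurable (A i)) -> Q (box A) = (\prod_i G i (A i))%E.

(** The conditional expectation of [h] given all coordinates but [i], when
    coordinate [i] is independent of the others and has law [G]. *)
Definition resample (G : probability T R) i h y : \bar R :=
  (\int[G]_u h (update y i u))%E.

Definition free_of {S : Type} i (g : n.-tuple T -> S) : Prop :=
  forall y u, g (update y i u) = g y.

Lemma tnth_update y i u j :
  tnth (update y i u) j = if j == i then u else tnth y j.
Proof. by rewrite tnth_mktuple. Qed.

Lemma update_permute (s : 'S_n) y i u :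
  permute s (update y (s i) u) = update (permute s y) i u.
Proof.
apply: eq_from_tnth => k; rewrite tnth_mktuple !tnth_update tnth_mktuple.
by rewrite (inj_eq perm_inj).
Qed.

Lemma measurable_update2 i :
  measurable_fun setT (fun z : n.-tuple T * T => update z.1 i z.2).
Proof.
apply/measurable_fun_tnthP => j.
rewrite (_ : _ \o _ = fun z => if j == i then z.2 else tnth z.1 j).
  case: (j == i); first exact: measurable_snd.
  apply: (@measurableT_comp _ _ _ _ _ _ (fun y : n.-tuple T => tnth y j)).
    exact: measurable_tnth.
  exact: measurable_fst.
by apply/funext => z /=; rewrite tnth_update.
Qed.

Lemma measurable_update y i : measurable_fun setT (update y i).
Proof.
apply: (@measurableT_comp _ _ _ _ _ _
  (fun z : n.-tuple T * T => update z.1 i z.2) setT (pair y)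
  (measurable_update2 i)).
exact: measurable_fun_pair.
Qed.

Lemma measurable_box (A : 'I_n -> set T) :
  (forall i, measurable (A i)) -> measurable (box A).
Proof.
move=> mA.
rewrite (_ : box A =
    \bigcap_(i in [set: 'I_n]) ((fun y => tnth y i) @^-1` A i)).
  apply: fin_bigcap_measurable => // i _.
  by rewrite -[X in measurable X]setTI; exact: measurable_tnth.
by apply/seteqP; split=> [y yA i _|y yA i]; exact: yA.
Qed.

(** Boxes form a pi-system that generates the sigma-algebra of tuples, so a
    finite measure is determined by its values on them. *)
Lemma measurable_boxE : (@measurable _ (n.-tuple T)) =
  <<s [set box A | A in [set A : 'I_n -> set T | forall i, measurable (A i)]] >>.
Proof.
apply/seteqP; split.
  apply: smallest_sub; first exact: smallest_sigma_algebra.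
  rewrite -bigcup_seq => B [i /= _ [A mA <-]].
  apply: sub_sigma_algebra; exists (fun j => if j == i then A else setT) => /=.
    by move=> j; case: ifP.
  rewrite setTI; apply/seteqP; split=> y /=.
    by move=> /(_ i); rewrite eqxx.
  by move=> yA j; case: eqP => // ->.
apply: smallest_sub; first exact: sigma_algebra_measurable.
by move=> B [A mA <-]; exact: measurable_box.
Qed.

Lemma eq_measure_box (m1 m2 : {measure set (n.-tuple T) -> \bar R}) :
  (forall A, (forall i, measurable (A i)) -> m1 (box A) = m2 (box A)) ->
  (m1 setT < +oo)%E ->
  forall B, measurable B -> m1 B = m2 B.
Proof.
move=> m12 m1T.
have TE : box (fun=> setT) = setT by apply/seteqP; split.
apply: (measure_unique
  [set box A | A in [set A : 'I_n -> set T | forall i, measurable (A i)]]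
  (fun=> setT)) => //.
- exact: measurable_boxE.
- move=> _ _ [A mA <-] [B mB <-]; exists (fun i => A i `&` B i).
    by move=> i; exact: measurableI.
  apply/seteqP; split=> [y /= yAB|y [yA yB] i].
    by split=> i; have [] := yAB i.
  by split; [exact: yA|exact: yB].
- by move=> _; exists (fun=> setT).
- by rewrite bigcup_const//; exists 0%N.
- by move=> _ [A mA <-]; exact: m12.
Qed.

Section resampling.
Variables (Q : probability (n.-tuple T) R) (G : 'I_n -> probability T R).
Hypothesis QG : product_law Q G.

Lemma measurable_resample (P : probability T R) i h :
  measurable_fun setT h -> (forall y, 0 <= h y)%E ->
  measurable_fun setT (resample P i h).
Proof.
move=> mh h0.
apply: (measurable_fun_fubini_tonelli_F (fun z : n.-tuple T * T => h (update z.1 i z.2))).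
  exact: (measurableT_comp mh (measurable_update2 i)).
by move=> z; exact: h0.
Qed.

Lemma resample_ge0 (P : probability T R) i h :
  (forall y, 0 <= h y)%E -> forall y, (0 <= resample P i h y)%E.
Proof. by move=> h0 y; apply: integral_ge0. Qed.

(** Fubini for a product law, one coordinate at a time: replacing a coordinate
    by an independent copy leaves the law unchanged, as both laws agree on
    boxes. *)
Lemma integral_resample i h :
  measurable_fun setT h -> (forall y, 0 <= h y)%E ->
  (\int[Q]_y resample (G i) i h y = \int[Q]_y h y)%E.
Proof.
move=> mh h0.
have mu2 := measurable_update2 i.
pose phi_mixin := isMeasurableFun.Build _ _ _ _ _ mu2.
pose phi : {mfun (n.-tuple T * T)%type >-> n.-tuple T} :=
  HB.pack (fun z : n.-tuple T * T => update z.1 i z.2) phi_mixin.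
transitivity (\int[pushforward (Q \x G i) phi]_y h y)%E.
  rewrite ge0_integral_pushforward// preimage_setT.
  rewrite fubini_tonelli1//.
  exact: (measurableT_comp mh).
  by move=> z; exact: h0.
apply: eq_measure_integral => B mB _.
apply/esym; move: B mB; apply: eq_measure_box; last first.
  by rewrite (le_lt_trans (probability_le1 Q _)) ?ltry.
  move=> A mA; apply/esym; pose A' j := if j == i then setT else A j.
  have mA' j : measurable (A' j) by rewrite /A'; case: ifP.
  transitivity (\prod_j G j (A j))%E; last by apply/esym; exact: QG.
  transitivity ((Q \x G i) (box A' `*` A i))%E.
    rewrite -[LHS]/((Q \x G i)%E (phi @^-1` box A)); congr ((Q \x G i)%E _).
    apply/seteqP; rewrite /A'; split=> -[y u] /=.
      move=> yA; split; last by have := yA i; rewrite tnth_update eqxx.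
      by move=> j; have := yA j; rewrite tnth_update; case: ifP.
    move=> [yA uA] j; have := yA j; rewrite tnth_update.
    by case: eqVneq => // ->.
  transitivity (Q (box A') * G i (A i))%E.
    by apply: product_measure1E => //; exact: measurable_box.
  rewrite QG// (bigD1 i)//= [RHS](bigD1 i)//= /A' eqxx probability_setT mul1e.
  rewrite muleC.
  by congr (_ * _)%E; apply: eq_bigr => j /negPf ->.
Qed.

End resampling.
End product_law.

(** * Calculus of resampling *)

Lemma integral_probability_cst d (T : measurableType d) (R : realType)
    (P : probability T R) (c : \bar R) : (\int[P]_u c = c)%E.
Proof.
rewrite integral_cst//.
transitivity (c * 1)%E; last exact: mule1.
congr (_ * _)%E; exact: probability_setT.
Qed.

Section resample_calculus.
Context {d : measure_display} {T : measurableType d} {R : realType} {n : nat}.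
Implicit Types (y : n.-tuple T) (i j : 'I_n) (h : n.-tuple T -> \bar R).
Variables (Q : probability (n.-tuple T) R) (G : 'I_n -> probability T R).
Hypothesis QG : product_law Q G.

Lemma measurable_coord {d'} {T' : measurableType d'} i (g : T -> T') :
  measurable_fun setT g -> measurable_fun setT (fun y : n.-tuple T => g (tnth y i)).
Proof. by move=> mg; exact: (measurableT_comp mg (measurable_tnth i)). Qed.

Lemma measurable_permute (s : 'S_n) :
  measurable_fun setT (permute s : n.-tuple T -> n.-tuple T).
Proof.
apply/measurable_fun_tnthP => j.
rewrite (_ : _ \o _ = fun y => tnth y (s j)); first exact: measurable_tnth.
by apply/funext => y /=; rewrite tnth_mktuple.
Qed.

Lemma resample_permute (P : probability T R) i (s : 'S_n) h y :
  resample P (s i) (h \o permute s) y = resample P i h (permute s y).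
Proof. by apply: eq_integral => u _ /=; rewrite update_permute. Qed.

(** The form in which coordinates are eliminated below: a bound that holds
    after integrating out coordinate [i] alone holds in expectation. *)
Lemma le_integral_resample i h1 h2 :
  measurable_fun setT h1 -> (forall y, 0 <= h1 y)%E ->
  measurable_fun setT h2 -> (forall y, 0 <= h2 y)%E ->
  (forall y, resample (G i) i h1 y <= h2 y)%E ->
  (\int[Q]_y h1 y <= \int[Q]_y h2 y)%E.
Proof.
move=> m1 h10 m2 h20 h12; rewrite -(integral_resample QG i m1 h10).
apply: ge0_le_integral => //.
- by move=> y _; exact: resample_ge0.
- exact: measurable_resample.
Qed.

Lemma integral_coord i (g : T -> \bar R) :
  measurable_fun setT g -> (forall u, 0 <= g u)%E ->
  (\int[Q]_y g (tnth y i) = \int[G i]_u g u)%E.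
Proof.
move=> mg g0; have mgi : measurable_fun setT (fun y : n.-tuple T => g (tnth y i)).
  exact: measurable_coord.
rewrite -(integral_resample QG i mgi)//.
under eq_integral => y _.
  rewrite /resample; under eq_integral do rewrite tnth_update eqxx.
  over.
exact: integral_probability_cst.
Qed.

(** Exchanging two independent observations changes the law by a density that
    factors over the two coordinates.  Once coordinates [i] and [j] have been
    resampled, the remaining function does not see whether they were exchanged
    beforehand; this is the common value [W] of both sides. *)
Lemma integral_tperm i j (r l : T -> R) h :
  i != j -> measurable_fun setT r -> (forall u, 0 <= r u) ->
  measurable_fun setT l -> (forall u, 0 <= l u) ->
  (forall phi : T -> \bar R, measurable_fun setT phi ->
     (forall u, 0 <= phi u)%E ->
     (\int[G i]_u (phi u * (r u)%:E) = \int[G j]_u phi u)%E) ->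
  (forall phi : T -> \bar R, measurable_fun setT phi ->
     (forall u, 0 <= phi u)%E ->
     (\int[G j]_u (phi u * (l u)%:E) = \int[G i]_u phi u)%E) ->
  measurable_fun setT h -> (forall y, 0 <= h y)%E ->
  (\int[Q]_y h (permute (tperm i j) y) =
   \int[Q]_y (h y * (r (tnth y i) * l (tnth y j))%:E))%E.
Proof.
move=> ij mr r0 ml l0 rE lE mh h0.
pose W := resample (G j) i (resample (G i) j h).
have mr' : measurable_fun setT (fun y => (r (tnth y i))%:E : \bar R).
  by apply/measurable_EFinP; exact: measurable_coord.
have ml' : measurable_fun setT (fun y => (l (tnth y j))%:E : \bar R).
  by apply/measurable_EFinP; exact: measurable_coord.
transitivity (\int[Q]_y W y)%E.
  have mhp : measurable_fun setT (h \o permute (tperm i j)).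
    exact: (measurableT_comp mh (measurable_permute _)).
  have hp0 y : (0 <= (h \o permute (tperm i j)) y)%E by exact: h0.
  transitivity (\int[Q]_y resample (G i) i (h \o permute (tperm i j)) y)%E.
    by apply/esym; exact: integral_resample.
  transitivity (\int[Q]_y resample (G j) j
      (resample (G i) i (h \o permute (tperm i j))) y)%E.
    apply/esym; apply: (integral_resample QG); first exact: measurable_resample.
    exact: resample_ge0.
  apply: eq_integral => y _.
  have e1 : resample (G i) i (h \o permute (tperm i j)) =
            resample (G i) j h \o permute (tperm i j).
    by apply/funext => z /=; rewrite -resample_permute tpermR.
  rewrite e1.
  have := resample_permute (G j) i (tperm i j) (resample (G i) j h) y.
  rewrite tpermL => ->.
  apply: eq_integral => u _; apply: eq_integral => v _; congr h.
  apply: eq_from_tnth => k; rewrite !tnth_update tnth_mktuple.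
  by case: eqVneq => // kj; case: eqVneq => // ki; rewrite tpermD// eq_sym.
have hrl0 y : (0 <= h y * (r (tnth y i) * l (tnth y j))%:E)%E.
  by rewrite mule_ge0// lee_fin mulr_ge0.
have mhrl : measurable_fun setT
    (fun y => h y * (r (tnth y i) * l (tnth y j))%:E)%E.
  by apply: emeasurable_funM => //; under eq_fun do rewrite EFinM; exact: emeasurable_funM.
have mhi : measurable_fun setT (resample (G i) j h) by exact: measurable_resample.
rewrite -(integral_resample QG j mhrl)//.
have -> : resample (G j) j (fun y => h y * (r (tnth y i) * l (tnth y j))%:E)%E =
          (fun y => resample (G i) j h y * (r (tnth y i))%:E)%E.
  apply/funext => y; rewrite /resample.
  under eq_integral => u _.
    rewrite !tnth_update eqxx (negPf ij) mulrC EFinM muleA.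
    over.
  have mhu : measurable_fun setT (fun u => h (update y j u)).
    exact: (measurableT_comp mh (measurable_update y j)).
  rewrite ge0_integralZr ?lee_fin//; last 2 first.
  - by apply: emeasurable_funM => //; exact/measurable_EFinP.
  - by move=> u _; rewrite mule_ge0 ?lee_fin.
  by rewrite lE.
transitivity (\int[Q]_y resample (G i) i
    (fun z => resample (G i) j h z * (r (tnth z i))%:E) y)%E; last first.
  apply: (integral_resample QG); first exact: emeasurable_funM.
  by move=> y; rewrite mule_ge0 ?lee_fin//; exact: resample_ge0.
apply: eq_integral => y _; rewrite /W {1 3}/resample.
under [RHS]eq_integral do rewrite tnth_update eqxx.
rewrite rE//.
- exact: (measurableT_comp mhi (measurable_update y i)).
- by move=> u; exact: resample_ge0.
Qed.

End resample_calculus.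

(** * Moment bounds for independent observations *)

Section one_observation.
Context {d : measure_display} {T : measurableType d} {R : realType}.
Variable P : probability T R.

(** One Bernoulli variable of parameter at least 1/2 raises the denominator by
    1/3 on average.  The constant 1/3 is the largest shift [x] with
    (1/b + 1/(b + 1)) / 2 <= 1/(b + x) for all [b] at least 1, and being
    additive it can be iterated. *)
Lemma integral_inv_indic (E : set T) (b c : R) :
  measurable E -> ((2^-1)%:E <= P E)%E -> 1 <= b -> 0 <= c ->
  (\int[P]_u (c / (b + \1_E u))%:E <= (c / (b + 3^-1))%:E)%E.
Proof.
move=> mE PE b1 c0.
have b0 : 0 < b by lra.
have den0 u : 0 < b + \1_E u :> R by rewrite ltr_wpDr// indicE ler0n.
pose dl := c / b - c / (b + 1).
have dl0 : 0 <= dl.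
  rewrite subr_ge0 ler_wpM2l// lef_pV2 ?posrE//; lra.
have mI : measurable_fun setT (fun u => (\1_E u)%:E : \bar R).
  by apply/measurable_EFinP; exact: measurable_indic.
have mf : measurable_fun setT (fun u => (c / (b + \1_E u))%:E).
  apply/measurable_EFinP; apply: measurable_funM => //.
  by apply: measurable_fun_invr; apply: measurable_funD => //; exact: measurable_indic.
(* [c / (b + 1_E)] is the affine function [c / b - dl * 1_E] of the indicator;
   the negative term is moved to the left to integrate nonnegative functions
   only. *)
have H : (\int[P]_u (c / (b + \1_E u))%:E + dl%:E * P E = (c / b)%:E)%E.
  transitivity (\int[P]_u ((c / (b + \1_E u))%:E + dl%:E * (\1_E u)%:E))%E.
    rewrite ge0_integralD//; first last.
    - exact: measurable_funeM.
    - by move=> u _; rewrite mule_ge0// lee_fin.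
    - by move=> u _; rewrite lee_fin divr_ge0// ltW.
    rewrite ge0_integralZl ?lee_fin//.
    by rewrite integral_indic// setIT.
  transitivity (\int[P]_u (c / b)%:E)%E; last exact: integral_probability_cst.
  apply: eq_integral => u _; rewrite -EFinM -EFinD; congr (_%:E).
  rewrite indicE /dl; case: (u \in E); rewrite /= ?addr0 ?mulr0 ?addr0//.
  by rewrite mulr1 addrC subrK.
have PEf : P E \is a fin_num := fin_num_measure P E mE.
move: PE H; rewrite -(fineK PEf) -EFinM lee_fin; set p := fine (P E) => p2 H.
rewrite -(@leeD2rE _ (dl * p)%:E)// -EFinD.
have -> : (\int[P]_u (c / (b + \1_E u))%:E + (dl * p)%:E = (c / b)%:E)%E by exact: H.
rewrite lee_fin.
have h1 : dl * 2^-1 <= dl * p by rewrite ler_wpM2l.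
apply: (@le_trans _ _ (c / (b + 3^-1) + dl * 2^-1)); last by rewrite lerD2l.
rewrite -subr_ge0.
have -> : c / (b + 3^-1) + dl * 2^-1 - c / b =
    c * (b - 1) / (6 * b * (b + 1) * (b + 3^-1)).
  rewrite /dl; field; lra.
apply: divr_ge0; first by rewrite mulr_ge0// subr_ge0.
by rewrite !mulr_ge0//; lra.
Qed.

(** [L - 1] is centred, so there is no cross term, and its variance is at most
    [V - 1]. *)
Lemma integral_sqr_affine (L : T -> R) (V a b : R) :
  measurable_fun setT L -> (forall u, 0 <= L u) ->
  (\int[P]_u (L u)%:E = 1)%E -> (\int[P]_u (L u ^+ 2)%:E <= V%:E)%E ->
  (\int[P]_u ((a + b * (L u - 1)) ^+ 2)%:E <= (a ^+ 2 + V * b ^+ 2)%:E)%E.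
Proof.
move=> mL L0 L1 LV.
pose e := a - b; pose k := `|2 * e * b|.
have k0 : 0 <= k by exact: normr_ge0.
have e0 (x : R) : (0 <= (x ^+ 2)%:E)%E by rewrite lee_fin sqr_ge0.
have kp : 0 <= k - 2 * e * b by rewrite subr_ge0 ler_norm.
have mLe : measurable_fun setT (fun u => (L u)%:E) by exact/measurable_EFinP.
have mL2 : measurable_fun setT (fun u => (L u ^+ 2)%:E).
  by apply/measurable_EFinP; exact: measurable_funX.
have mf : measurable_fun setT (fun u => ((a + b * (L u - 1)) ^+ 2)%:E).
  apply/measurable_EFinP; apply: measurable_funX.
  apply: measurable_funD => //; apply: measurable_funM => //.
  exact: measurable_funB.
have ZL c : 0 <= c -> (\int[P]_u (c%:E * (L u)%:E) = c%:E)%E.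
  move=> c0; rewrite -[RHS]mule1 -L1 ge0_integralZl ?lee_fin//.
  by move=> u _; rewrite lee_fin.
(* Expanding around [e = a - b], the linear term [2 * e * b * L] may be
   negative; adding [(k - 2 * e * b) * L] with [k = |2 * e * b|] makes both
   sides sums of nonnegative functions. *)
have H : (\int[P]_u ((a + b * (L u - 1)) ^+ 2)%:E + (k - 2 * e * b)%:E =
    (e ^+ 2 + k)%:E + (b ^+ 2)%:E * \int[P]_u (L u ^+ 2)%:E)%E.
  transitivity (\int[P]_u (((a + b * (L u - 1)) ^+ 2)%:E +
      (k - 2 * e * b)%:E * (L u)%:E))%E.
    rewrite ge0_integralD//; first last.
    - exact: measurable_funeM.
    - by move=> u _; rewrite mule_ge0// lee_fin.
    by rewrite ZL.
  transitivity (\int[P]_u ((e ^+ 2)%:E + ((b ^+ 2)%:E * (L u ^+ 2)%:E +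
      k%:E * (L u)%:E)))%E.
    apply: eq_integral => u _; rewrite -!EFinM -!EFinD; congr (_%:E).
    rewrite /e; ring.
  rewrite ge0_integralD//; first last.
  - by apply: emeasurable_funD; exact: measurable_funeM.
  - by move=> u _; apply: adde_ge0; apply: mule_ge0; rewrite ?e0 ?lee_fin.
  rewrite ge0_integralD//; first last.
  - exact: measurable_funeM.
  - by move=> u _; rewrite mule_ge0 ?lee_fin.
  - exact: measurable_funeM.
  - by move=> u _; rewrite mule_ge0.
  rewrite ZL// integral_probability_cst.
  rewrite ge0_integralZl//.
  by rewrite EFinD -addeA; congr (_ + _)%E; exact: addeC.
rewrite -(@leeD2rE _ (k - 2 * e * b)%:E)//.
have -> : (\int[P]_u ((a + b * (L u - 1)) ^+ 2)%:E + (k - 2 * e * b)%:E =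
    (e ^+ 2 + k)%:E + (b ^+ 2)%:E * \int[P]_u (L u ^+ 2)%:E)%E by exact: H.
apply: (@le_trans _ _ ((e ^+ 2 + k)%:E + (b ^+ 2)%:E * V%:E)%E).
  by rewrite leeD2lE// lee_wpmul2l// lee_fin sqr_ge0.
rewrite -!EFinM -!EFinD lee_fin /e -subr_ge0.
have -> : a ^+ 2 + V * b ^+ 2 + (k - 2 * (a - b) * b) -
  ((a - b) ^+ 2 + k + b ^+ 2 * V) = b ^+ 2 by ring.
exact: sqr_ge0.
Qed.

End one_observation.

Section many_observations.
Context {d : measure_display} {T : measurableType d} {R : realType} {n : nat}.
Implicit Types (y : n.-tuple T) (i j k : 'I_n).
Variables (Q : probability (n.-tuple T) R) (G : 'I_n -> probability T R).
Hypothesis QG : product_law Q G.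

(** The reciprocal of a count of independent events, each of probability at
    least 1/2, is in mean of the order of the reciprocal of their number.  The
    factor [phi] collects everything that is independent of these events; the
    base [a] is a function so that in the induction it absorbs the indicators
    that are still to be integrated out. *)
Lemma integral_inv_count (E : 'I_n -> set T) (s : seq 'I_n)
    (phi a : n.-tuple T -> R) :
  uniq s -> (forall k, measurable (E k)) ->
  (forall k, k \in s -> ((2^-1)%:E <= G k (E k))%E) ->
  measurable_fun setT phi -> (forall y, 0 <= phi y) ->
  (forall k, k \in s -> free_of k phi) ->
  measurable_fun setT a -> (forall y, 1 <= a y) ->
  (forall k, k \in s -> free_of k a) ->
  (\int[Q]_y (phi y / (a y + \sum_(k <- s) \1_(E k) (tnth y k)))%:E <=
   \int[Q]_y (phi y / (a y + (size s)%:R / 3))%:E)%E.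
Proof.
move=> + mE + mphi phi0; elim: s a => [|k s IH] a.
  by move=> _ _ _ _ _ _; under eq_integral do rewrite big_nil -(mul0r 3^-1).
move=> /= /andP[ks us] Ehalf phis ma a1 as_.
have mEk : measurable_fun setT (fun y => \1_(E k) (tnth y k) : R).
  apply: (measurable_coord k (g := \1_(E k) : T -> R)); exact: measurable_indic.
have ind0 j u : 0 <= \1_(E j) u :> R by rewrite indicE ler0n.
have mden (b : n.-tuple T -> R) : measurable_fun setT b ->
    measurable_fun setT (fun y => (phi y / b y)%:E).
  move=> mb; apply/measurable_EFinP; apply: measurable_funM => //.
  exact: measurable_fun_invr.
have ns : 0 <= (size s)%:R / 3 :> R by rewrite divr_ge0// ler0n.
have nk : (size s).+1%:R / 3 = (size s)%:R / 3 + 3^-1 :> R.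
  by rewrite -natr1 mulrDl mul1r.
apply: (@le_trans _ _
  (\int[Q]_y (phi y / ((a y + \1_(E k) (tnth y k)) + (size s)%:R / 3))%:E)%E).
  under eq_integral do rewrite big_cons addrA.
  apply: (IH (fun y => a y + \1_(E k) (tnth y k))) => //.
  - by move=> j js; apply: Ehalf; rewrite inE js orbT.
  - by move=> j js; apply: phis; rewrite inE js orbT.
  - exact: measurable_funD.
  - by move=> y; rewrite (le_trans (a1 y))// lerDl.
  - move=> j js y u; rewrite as_ ?inE ?js ?orbT// tnth_update.
    by case: eqVneq js => // <- /(negP ks).
have kk : k \in k :: s by rewrite inE eqxx.
apply: (le_integral_resample QG (i := k)).
- by apply: mden; apply: measurable_funD => //; exact: measurable_funD.
- by move=> y; rewrite lee_fin divr_ge0// !addr_ge0// (le_trans _ (a1 y)).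
- by apply: mden; exact: measurable_funD.
- by move=> y; rewrite lee_fin divr_ge0// addr_ge0// ?(le_trans _ (a1 y))// divr_ge0.
move=> y; rewrite /resample.
under eq_integral => u _.
  rewrite phis// as_// tnth_update eqxx addrAC.
  over.
rewrite nk addrA; apply: integral_inv_indic => //; first exact: Ehalf.
by rewrite ler_wpDr.
Qed.

(** Variances of independent centred variables add up, with coefficients [b k]
    that may depend on coordinates outside [s].  The constant [c] is a function
    for the same reason as [a] in [integral_inv_count]. *)
Lemma integral_sqr_affine_sum (Z : 'I_n -> T -> R) (V : R) (s : seq 'I_n)
    (phi c : n.-tuple T -> R) (b : 'I_n -> n.-tuple T -> R) :
  uniq s -> 0 <= V -> (forall k, measurable_fun setT (Z k)) ->
  (forall k, k \in s -> forall x z : R,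
    (\int[G k]_u ((x + z * Z k u) ^+ 2)%:E <= (x ^+ 2 + V * z ^+ 2)%:E)%E) ->
  measurable_fun setT phi -> (forall y, 0 <= phi y) ->
  (forall k, k \in s -> free_of k phi) ->
  (forall j, measurable_fun setT (b j)) ->
  (forall k, k \in s -> forall j, free_of k (b j)) ->
  measurable_fun setT c -> (forall k, k \in s -> free_of k c) ->
  (\int[Q]_y (phi y * (c y + \sum_(k <- s) b k y * Z k (tnth y k)) ^+ 2)%:E <=
   \int[Q]_y (phi y * (c y ^+ 2 + V * \sum_(k <- s) b k y ^+ 2))%:E)%E.
Proof.
move=> + V0 mZ + mphi phi0 + mb.
elim: s c => [|k s IH] c.
  by move=> *; under eq_integral do rewrite big_nil addr0;
    under [leRHS]eq_integral do rewrite big_nil mulr0 addr0.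
move=> /= /andP[ks us] ZV phis bs mc cs.
have mZk j : measurable_fun setT (fun y => Z j (tnth y j)).
  exact: measurable_coord.
have msum2 : measurable_fun setT (fun y => \sum_(j <- s) b j y ^+ 2).
  by apply: measurable_sum => j; exact: measurable_funX.
have sum20 y : 0 <= \sum_(j <- s) b j y ^+ 2.
  by apply: sumr_ge0 => j _; exact: sqr_ge0.
have mcb : measurable_fun setT (fun y => c y + b k y * Z k (tnth y k)).
  by apply: measurable_funD => //; exact: measurable_funM.
have kk : k \in k :: s by rewrite inE eqxx.
apply: (@le_trans _ _ (\int[Q]_y (phi y * ((c y + b k y * Z k (tnth y k)) ^+ 2 +
    V * \sum_(j <- s) b j y ^+ 2))%:E)%E).
  under eq_integral do rewrite big_cons addrA.
  apply: (IH (fun y => c y + b k y * Z k (tnth y k))) => //.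
  - by move=> j js; apply: ZV; rewrite inE js orbT.
  - by move=> j js; apply: phis; rewrite inE js orbT.
  - by move=> j js; apply: bs; rewrite inE js orbT.
  - move=> j js y u; rewrite cs ?bs ?inE ?js ?orbT// tnth_update.
    by case: eqVneq js => // <- /(negP ks).
apply: (le_integral_resample QG (i := k)).
- apply/measurable_EFinP; apply: measurable_funM => //.
  by apply: measurable_funD; [exact: measurable_funX|exact: measurable_funM].
- by move=> y; rewrite lee_fin mulr_ge0// addr_ge0 ?sqr_ge0// mulr_ge0.
- apply/measurable_EFinP; apply: measurable_funM => //.
  apply: measurable_funD; first exact: measurable_funX.
  apply: measurable_funM => //.
  by apply: measurable_sum => j; exact: measurable_funX.
- move=> y; rewrite lee_fin mulr_ge0// addr_ge0 ?sqr_ge0// mulr_ge0//.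
  by apply: sumr_ge0 => j _; exact: sqr_ge0.
move=> y; rewrite /resample.
under eq_integral => u _.
  rewrite phis// cs// bs// tnth_update eqxx.
  under eq_bigr do rewrite bs//.
  rewrite EFinM EFinD.
  over.
have mst : measurable_fun setT (fun u => ((c y + b k y * Z k u) ^+ 2)%:E).
  apply/measurable_EFinP; apply: measurable_funX; apply: measurable_funD => //.
  exact: measurable_funM.
have c0 : 0 <= V * \sum_(j <- s) b j y ^+ 2 by rewrite mulr_ge0.
rewrite ge0_integralZl ?lee_fin//; last 2 first.
- exact: emeasurable_funD.
- by move=> u _; rewrite -EFinD lee_fin addr_ge0// sqr_ge0.
rewrite [leRHS]EFinM; apply: lee_wpmul2l; first by rewrite lee_fin.
rewrite ge0_integralD//; last first.
- by move=> u _; rewrite lee_fin sqr_ge0.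
rewrite integral_probability_cst big_cons mulrDr addrA [in leRHS]EFinD.
by rewrite leeD2rE//; exact: ZV.
Qed.

End many_observations.

(** * The pointwise inequalities *)

Section algebra.
Variable R : realFieldType.

(** The left side minus the first sum on the right is largest when [x] is the
    weighted mean of [th], where it equals the last term. *)
Lemma weighted_sqr_le (I : finType) (w th : I -> R) (s x : R) :
  0 < \sum_i w i ->
  \sum_i w i * (s - th i) ^+ 2 <=
  \sum_i w i * (x - th i) ^+ 2 + (\sum_i w i * (s - th i)) ^+ 2 / \sum_i w i.
Proof.
set W := \sum_i w i; set N := \sum_i w i * (s - th i) => W0.
have -> : \sum_i w i * (x - th i) ^+ 2 =
    \sum_i w i * (s - th i) ^+ 2 + 2 * (x - s) * N + (x - s) ^+ 2 * W.
  rewrite /N /W !mulr_sumr -!big_split/=; apply: eq_bigr => i _; ring.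
rewrite -addrA -addrA lerDl.
have -> : 2 * (x - s) * N + ((x - s) ^+ 2 * W + N ^+ 2 / W) =
    ((x - s) * W + N) ^+ 2 / W by field; rewrite gt_eqF.
by rewrite divr_ge0 ?sqr_ge0// ltW.
Qed.

Lemma sum_uniq_le (I : finType) (s : seq I) (a : I -> R) :
  uniq s -> (forall i, 0 <= a i) -> \sum_(i <- s) a i <= \sum_i a i.
Proof.
move=> us a0; rewrite big_uniq//= [leLHS]big_mkcond/=.
by apply: ler_sum => i _; case: ifP.
Qed.

(** The upper bound for the excess at a fixed sample.  Here [p i] stands for
    p_i(Y_0), [l i] for L_i and [c i] for the indicator of L_i > gamma.  Two
    inequalities are used: (UA + UB)^2 <= 2 UA^2 + 2 UB^2 for the numerator, and
    for the denominator sum_i p_i l_i >= g pmin (1 + sum_(i in D) c_i), where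
    [D] is the half that is absent from the numerator and the summand 1 comes from
    [l ord0 = 1]. *)
Lemma swap_weight_bound m (p l th : 'I_m.+1 -> R) (A B : seq 'I_m.+1)
    (c : 'I_m.+1 -> R) (pmin g s : R) :
  let b i := p i * (s - th i) in
  let w i := p i / p ord0 * l i in
  perm_eq (ord0 :: A ++ B) (index_enum 'I_m.+1) ->
  (forall i, 0 < p i) -> \sum_i p i = 1 -> s = \sum_i th i * p i ->
  0 < pmin -> (forall i, pmin <= p i) -> 0 < g -> g <= 1 ->
  (forall i, 0 < l i) -> l ord0 = 1 ->
  (forall i, 0 <= c i) -> (forall i, g * c i <= l i) ->
  (\sum_i w i * (s - th i)) ^+ 2 / \sum_i w i <=
  2 / g * ((p ord0 * pmin)^-1 *
    ((\sum_(i <- A) b i * (l i - 1)) ^+ 2 / (1 + \sum_(i <- B) c i) +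
     (\sum_(i <- B) b i * (l i - 1)) ^+ 2 / (1 + \sum_(i <- A) c i))).
Proof.
move=> b w pAB p0 p1 sE pm0 pmp g0 g1 l0 l01 c0 cl.
have sumE (F : 'I_m.+1 -> R) : \sum_i F i =
    F ord0 + (\sum_(i <- A) F i + \sum_(i <- B) F i).
  by rewrite -(perm_big _ pAB)/= big_cons big_cat.
set UA := \sum_(i <- A) _; set UB := \sum_(i <- B) b i * _.
set NA := \sum_(i <- A) c i; set NB := \sum_(i <- B) c i.
have NA0 : 0 <= NA by apply: sumr_ge0.
have NB0 : 0 <= NB by apply: sumr_ge0.
pose Lb := \sum_i p i * l i.
have p00 := p0 ord0; have ppm : 0 < p ord0 * pmin by rewrite mulr_gt0.
have wE : \sum_i w i = Lb / p ord0.
  by rewrite /Lb mulr_suml; apply: eq_bigr => i _; rewrite /w; ring.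
(* Since sum_i p_i (s - th_i) = 0, each [l i] may be replaced by [l i - 1]. *)
have Nm : \sum_i w i * (s - th i) = (UA + UB) / p ord0.
  transitivity ((\sum_i b i * (l i - 1)) / p ord0); last first.
    by congr (_ / _); rewrite sumE l01 subrr mulr0 add0r.
  have b0 : \sum_i b i = 0.
    rewrite /b; under eq_bigr do rewrite mulrBr (mulrC _ s) (mulrC _ (th _)).
    by rewrite sumrB -mulr_sumr p1 mulr1 -sE subrr.
  rewrite -[X in X / _]addr0 -[X in _ + X]b0 -big_split/= mulr_suml.
  by apply: eq_bigr => i _; rewrite /w /b; ring.
have Lb_ge (D : seq 'I_m.+1) : D = A \/ D = B ->
    g * pmin * (1 + \sum_(i <- D) c i) <= Lb.
  move=> DAB; apply: (@le_trans _ _ (pmin * (1 + \sum_(i <- D) l i))).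
    rewrite (mulrC g) -mulrA ler_wpM2l ?(ltW pm0)// mulrDr mulr1 lerD//.
    by rewrite mulr_sumr; apply: ler_sum => i _.
  have pl D' : pmin * \sum_(i <- D') l i <= \sum_(i <- D') p i * l i.
    by rewrite mulr_sumr; apply: ler_sum => i _; rewrite ler_wpM2r// ltW.
  have pl0 D' : 0 <= \sum_(i <- D') p i * l i.
    by apply: sumr_ge0 => i _; rewrite mulr_ge0// ltW.
  rewrite mulrDr mulr1 /Lb sumE l01 mulr1 lerD//.
  by case: DAB => ->; apply: (le_trans (pl _)); rewrite ?lerDl ?lerDr.
have Lb0 : 0 < Lb.
  apply: lt_le_trans (Lb_ge A _); last by left.
  by rewrite !mulr_gt0// ltr_wpDr.
have key (U : R) (D : seq 'I_m.+1) : D = A \/ D = B ->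
    U ^+ 2 / (p ord0 * Lb) <=
    g^-1 * ((p ord0 * pmin)^-1 * (U ^+ 2 / (1 + \sum_(i <- D) c i))).
  move=> DAB; have D0 : 0 < 1 + \sum_(i <- D) c i.
    by rewrite ltr_wpDr// sumr_ge0.
  rewrite (_ : g^-1 * _ = U ^+ 2 / (p ord0 * (g * pmin * (1 + \sum_(i <- D) c i)))).
    rewrite ler_wpM2l ?sqr_ge0// lef_pV2 ?posrE ?mulr_gt0//.
    by rewrite ler_pM2l//; exact: Lb_ge.
  by field; rewrite !gt_eqF.
rewrite Nm wE.
have -> : ((UA + UB) / p ord0) ^+ 2 / (Lb / p ord0) =
    (UA + UB) ^+ 2 / (p ord0 * Lb) by field; rewrite !gt_eqF.
apply: (@le_trans _ _ (2 * (UA ^+ 2 / (p ord0 * Lb)) + 2 * (UB ^+ 2 / (p ord0 * Lb)))).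
  have X0 : 0 <= (p ord0 * Lb)^-1 by rewrite invr_ge0 ltW// mulr_gt0.
  rewrite -mulrDr -mulrDl mulrA; apply: (ler_wpM2r X0).
  rewrite -subr_ge0 (_ : _ - _ = (UA - UB) ^+ 2) ?sqr_ge0//; ring.
have kA := key UA B (or_intror erefl); have kB := key UB A (or_introl erefl).
rewrite -/NA in kB; rewrite -/NB in kA.
apply: (le_trans (lerD (ler_wpM2l _ kA) (ler_wpM2l _ kB))) => //.
by rewrite le_eqVlt; apply/orP; left; apply/eqP; ring.
Qed.

End algebra.

(** * Regret of the simple posterior mean for a finite family *)

Section posterior_mean_regret.
Context {d : measure_display} {T : measurableType d} {R : realType} {m : nat}.
Local Notation n := m.+1.
Variable nu : {measure set T -> \bar R}.
Variables (G : 'I_n -> probability T R) (g : 'I_n -> T -> R) (th : 'I_n -> R).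
Variables (Q : probability (n.-tuple T) R) (pmin : T -> R) (C gamma : R).
Hypothesis QG : product_law Q G.
Hypothesis Gg : forall i, is_density nu (G i) (g i).
Hypothesis g_gt0 : forall i, {ae G i, forall u, forall j, 0 < g j u}.

Hypothesis th_le : forall i, `|th i| <= C.
Hypothesis ratio_sqr : forall i j,
  (\int[G i]_u ((g j u / g i u) ^+ 2)%:E <= C%:E)%E.
Hypothesis gamma_gt0 : 0 < gamma.
Hypothesis ratio_half : forall i j,
  ((2^-1)%:E <= G i [set u | (gamma < g j u / g i u)%R])%E.

Let p i u : R := g i u / \sum_j g j u.
Let pm u : R := \sum_i th i * p i u.

Hypothesis mpmin : measurable_fun setT pmin.
Hypothesis pmin_ge0 : forall u, 0 <= pmin u.
Hypothesis pmin_le : forall u, (forall j, 0 < g j u) ->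
  0 < pmin u /\ forall j, pmin u <= p j u.
Hypothesis sqr_pmin : (\sum_i \int[G i]_u
  ((\sum_j p j u ^+ 2) / (n%:R * pmin u))%:E <= C%:E)%E.

Let mg i : measurable_fun setT (g i). Proof. by have [] := Gg i. Qed.
Let g0 i u : 0 <= g i u. Proof. by have [] := Gg i. Qed.

Let p_ge0 i u : 0 <= p i u.
Proof. by rewrite divr_ge0// sumr_ge0. Qed.

Let mp i : measurable_fun setT (p i).
Proof.
apply: measurable_funM => //; apply: measurable_fun_invr.
exact: measurable_sum.
Qed.

Let mpm : measurable_fun setT pm.
Proof. by apply: measurable_sum => i; exact: measurable_funM. Qed.

Let mratio i j : measurable_fun setT (fun u => g i u / g j u).
Proof. by apply: measurable_funM => //; exact: measurable_fun_invr. Qed.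

Let ratio_ge0 i j u : 0 <= g i u / g j u.
Proof. by rewrite divr_ge0. Qed.

Let change i j (phi : T -> \bar R) : measurable_fun setT phi ->
  (forall u, 0 <= phi u)%E ->
  (\int[G i]_u (phi u * (g j u / g i u)%:E) = \int[G j]_u phi u)%E.
Proof.
move=> mphi phi0; apply: integral_density_ratio => //.
by apply: filterS (g_gt0 j) => u; exact.
Qed.

Lemma ae_sample_density_gt0 : {ae Q, forall y, forall i j, 0 < g j (tnth y i)}.
Proof.
apply: filter_forall => i.
have [N [mN N0 sN]] := g_gt0 i.
exists [set y | N (tnth y i)]; split.
- by rewrite -[X in measurable X]setTI; exact: (measurable_tnth i).
- have mI : measurable_fun setT (fun u => (\1_N u)%:E : \bar R).
    by apply/measurable_EFinP; exact: measurable_indic.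
  have I0 u : (0 <= (\1_N u)%:E :> \bar R)%E by rewrite lee_fin indicE ler0n.
  have := integral_coord QG i mI I0.
  rewrite [RHS]integral_indic// setIT => e.
  transitivity (\int[Q]_y (\1_[set y | N (tnth y i)] y)%:E)%E.
    have mNi : measurable [set y : n.-tuple T | N (tnth y i)].
      by rewrite -[X in measurable X]setTI; exact: (measurable_tnth i).
    by rewrite integral_indic// setIT.
  rewrite -N0 -e; apply: eq_integral => y _; rewrite !indicE.
  by congr ((nat_of_bool _)%:R%:E); apply/idP/idP => /set_mem H; exact/mem_set.
- by move=> y /= H; apply: sN.
Qed.

(** The density of the sample in which observations 0 and [i] are exchanged. *)
Let lam i (y : n.-tuple T) : R :=
  g i (tnth y ord0) / g ord0 (tnth y ord0) * (g ord0 (tnth y i) / g i (tnth y i)).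

Let lam_ge0 i y : 0 <= lam i y.
Proof. by rewrite mulr_ge0. Qed.

Let mlam i : measurable_fun setT (lam i).
Proof.
apply: measurable_funM.
  exact: (measurable_coord ord0 (mratio i ord0)).
exact: (measurable_coord i (mratio ord0 i)).
Qed.

(** For [i] distinct from 0 this is [integral_tperm]; for [i = 0] nothing is
    exchanged and [lam ord0] is 1 almost surely. *)
Lemma integral_tperm_ord0 i (h : n.-tuple T -> \bar R) :
  measurable_fun setT h -> (forall y, 0 <= h y)%E ->
  (\int[Q]_y h (permute (tperm ord0 i) y) = \int[Q]_y (h y * (lam i y)%:E))%E.
Proof.
move=> mh h0; have [->|i0] := eqVneq i ord0.
  apply: ge0_ae_eq_integral => //.
  - exact: (measurableT_comp mh (measurable_permute _)).
  - by apply: emeasurable_funM => //; exact/measurable_EFinP.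
  - by move=> y _; rewrite mule_ge0// lee_fin.
  apply: filterS ae_sample_density_gt0 => y yp _.
  have -> : lam ord0 y = 1 by rewrite /lam !divff ?mulr1// gt_eqF.
  rewrite mule1 tperm1; congr h; apply: eq_from_tnth => k.
  by rewrite tnth_mktuple perm1.
apply: (@integral_tperm _ _ _ _ Q G QG ord0 i (fun u => g i u / g ord0 u)
  (fun u => g ord0 u / g i u)) => //; first by rewrite eq_sym.
- by move=> phi mphi phi0; exact: change.
- by move=> phi mphi phi0; exact: change.
Qed.

Let C_ge0 : 0 <= C. Proof. exact: le_trans (th_le ord0). Qed.

(** 1/p_0 = sum_i g_i/g_0, and integrating against g_i/g_0 turns the law of the
    first observation into [G i]. *)
Lemma integral_div_posterior (phi : T -> R) :
  measurable_fun setT phi -> (forall u, 0 <= phi u) ->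
  (\int[G ord0]_u (phi u / p ord0 u)%:E = \sum_i \int[G i]_u (phi u)%:E)%E.
Proof.
move=> mphi phi0.
have mphie : measurable_fun setT (fun u => (phi u)%:E) by exact/measurable_EFinP.
transitivity (\int[G ord0]_u \sum_i ((phi u)%:E * (g i u / g ord0 u)%:E))%E.
  apply: eq_integral => u _.
  rewrite -ge0_sume_distrr; last by move=> i _; rewrite lee_fin.
  rewrite sumEFin -EFinM -mulr_suml; congr (_ * _)%:E.
  by rewrite /p invf_div.
rewrite ge0_integral_sum//; last 2 first.
- by move=> i; apply: emeasurable_funM => //; exact/measurable_EFinP.
- by move=> i u _; rewrite mule_ge0// lee_fin.
by apply: eq_bigr => i _; rewrite change// => u; rewrite lee_fin.
Qed.

Let sum_p u : \sum_i p i u <= 1.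
Proof.
rewrite -mulr_suml; set S := \sum_i _.
by have [->|S0] := eqVneq S 0; rewrite ?mul0r// divff.
Qed.

Let pm_le u : `|pm u| <= C.
Proof.
apply: (le_trans (ler_norm_sum _ _ _)).
apply: (@le_trans _ _ (C * \sum_i p i u)); last by rewrite ler_piMr.
rewrite mulr_sumr; apply: ler_sum => i _.
by rewrite normrM (ger0_norm (p_ge0 _ _)) ler_wpM2r.
Qed.

Let b k u := p k u * (pm u - th k).

Let mb k : measurable_fun setT (b k).
Proof. by apply: measurable_funM => //; exact: measurable_funB. Qed.

Let b_sqr k u : b k u ^+ 2 <= (4 * C ^+ 2) * p k u ^+ 2.
Proof.
rewrite /b exprMn mulrC ler_wpM2r ?sqr_ge0//.
rewrite -real_normK ?num_real// (_ : 4 * C ^+ 2 = (2 * C) ^+ 2); last by ring.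
rewrite lerXn2r ?nnegrE//; first by rewrite mulr_ge0.
rewrite (le_trans (ler_normB _ _))// mulr_natl mulr2n lerD//.
Qed.

Let E k : set T := [set u | gamma < g ord0 u / g k u].

Let mE k : measurable (E k).
Proof.
rewrite -[E k]setTI (_ : E k = (fun u => g ord0 u / g k u) @^-1` `]gamma, +oo[).
  exact: mratio.
by apply/seteqP; split => u /=; rewrite in_itv/= andbT.
Qed.

Let Z k u : R := g ord0 u / g k u - 1.

Let mZ k : measurable_fun setT (Z k).
Proof. exact: measurable_funB. Qed.

Let ratio_int i j : (\int[G i]_u (g j u / g i u)%:E = 1)%E.
Proof.
transitivity (\int[G j]_u 1%E)%E; last exact: integral_probability_cst.
by rewrite -[RHS](@change i j (fun=> 1%E))//; apply: eq_integral => u _; rewrite mul1e.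
Qed.

(** The numerator depends on the observations in [A], the denominator on those
    in [B], and both on observation 0 through [p], [pmin] and [b].  First the
    count over [B] is integrated out, then the centred variables over [A]; the
    last step replaces observation 0 under [G ord0] by the mixture of all
    [G i]. *)
Lemma half_sample_bound (A B : seq 'I_n) : uniq (A ++ B) ->
  ord0 \notin A ++ B -> (n <= 6 + 2 * size B)%N ->
  (\int[Q]_y ((p ord0 (tnth y ord0) * pmin (tnth y ord0))^-1 *
      ((\sum_(k <- A) b k (tnth y ord0) * Z k (tnth y k)) ^+ 2 /
       (1 + \sum_(k <- B) \1_(E k) (tnth y k))))%:E
    <= (24 * C ^+ 4)%:E)%E.
Proof.
rewrite cat_uniq mem_cat negb_or => /and3P[uA AB uB] /andP[A0 B0] nB.
pose w u : R := (p ord0 u * pmin u)^-1.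
have w0 u : 0 <= w u by rewrite invr_ge0 mulr_ge0.
have mw : measurable_fun setT w by apply: measurable_fun_invr; exact: measurable_funM.
pose phi y := w (tnth y ord0) *
  (0 + \sum_(k <- A) b k (tnth y ord0) * Z k (tnth y k)) ^+ 2.
have phi0 y : 0 <= phi y by rewrite mulr_ge0// sqr_ge0.
have mw0 : measurable_fun setT (fun y : n.-tuple T => w (tnth y ord0)).
  exact: measurable_coord.
have mb0 k : measurable_fun setT (fun y : n.-tuple T => b k (tnth y ord0)).
  exact: (measurable_coord ord0 (mb k)).
have mphi : measurable_fun setT phi.
  apply: measurable_funM => //; apply: measurable_funX; apply: measurable_funD => //.
  apply: measurable_sum => k; apply: measurable_funM => //.
  exact: (measurable_coord k (mZ k)).
have nA k : k \in A -> ord0 != k by move=> kA; apply: contraNneq A0 => ->.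
have nBk k : k \in B -> ord0 != k by move=> kB; apply: contraNneq B0 => ->.
have fphi k : k \in B -> free_of k phi.
  move=> kB y u; rewrite /phi tnth_update (negPf (nBk k kB)); congr (_ * (_ + _) ^+ 2).
  apply: eq_big_seq => j jA; rewrite tnth_update; case: eqVneq => // jk.
  by case/hasP: AB; exists k => //; rewrite -jk.
pose s := 1 + (size B)%:R / 3 : R.
have s0 : 0 < s by rewrite ltr_wpDr// divr_ge0.
apply: (@le_trans _ _ (\int[Q]_y (phi y / s)%:E)%E).
  under eq_integral do rewrite mulrA -[X in X ^+ 2]add0r.
  apply: (integral_inv_count QG (a := fun=> 1)) => // k kB. exact: ratio_half.
apply: (@le_trans _ _ (\int[Q]_y (w (tnth y ord0) / s *
    (0 ^+ 2 + C * \sum_(k <- A) b k (tnth y ord0) ^+ 2))%:E)%E).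
  under eq_integral do rewrite /phi mulrAC.
  apply: (integral_sqr_affine_sum QG (Z := Z) (phi := fun y => w (tnth y ord0) / s)
    (c := fun=> 0) (b := fun k y => b k (tnth y ord0))) => //.
  - move=> k kA x z; apply: integral_sqr_affine => //.
  - by apply: measurable_funM.
  - by move=> y; rewrite divr_ge0// ltW.
  - by move=> k kA y u; rewrite tnth_update (negPf (nA k kA)).
  - by move=> k kA j y u; rewrite tnth_update (negPf (nA k kA)).
pose psi u : R := (\sum_j p j u ^+ 2) / (n%:R * pmin u).
have mpsi : measurable_fun setT psi.
  apply: measurable_funM; first by apply: measurable_sum => j; exact: measurable_funX.
  by apply: measurable_fun_invr; exact: measurable_funM.
have psi0 u : 0 <= psi u.
  by rewrite divr_ge0 ?mulr_ge0// sumr_ge0// => j _; exact: sqr_ge0.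
have mpp : measurable_fun setT (fun u => (psi u / p ord0 u)%:E).
  by apply/measurable_EFinP; apply: measurable_funM => //; exact: measurable_fun_invr.
have pp0 u : (0 <= (psi u / p ord0 u)%:E)%E by rewrite lee_fin divr_ge0.
apply: (@le_trans _ _ (\int[Q]_y ((24 * C ^+ 3)%:E *
    (psi (tnth y ord0) / p ord0 (tnth y ord0))%:E))%E).
  apply: ge0_le_integral => //.
  - move=> y _; rewrite lee_fin mulr_ge0 ?divr_ge0 ?(ltW s0)// addr_ge0 ?sqr_ge0//.
    by rewrite mulr_ge0// sumr_ge0// => k _; exact: sqr_ge0.
  - apply/measurable_EFinP; apply: measurable_funM => //; first exact: measurable_funM.
    apply: measurable_funD => //; apply: measurable_funM => //.
    by apply: measurable_sum => k; exact: measurable_funX.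
  - by apply: measurable_funeM; exact: (measurable_coord ord0 mpp).
  move=> y _; set u := tnth y ord0.
  rewrite -EFinM lee_fin expr0n/= add0r.
  have sb : \sum_(k <- A) b k u ^+ 2 <= 4 * C ^+ 2 * \sum_j p j u ^+ 2.
    rewrite mulr_sumr; apply: le_trans (sum_uniq_le uA _) => [|j]; last first.
      by apply: mulr_ge0; [apply: mulr_ge0 => //; exact: sqr_ge0|exact: sqr_ge0].
    by apply: ler_sum => k _; exact: b_sqr.
  (* [s = 1 + size B / 3] and [n <= 6 + 2 * size B]. *)
  have sn : s^-1 <= 6 / n%:R.
    rewrite -[leRHS]invrK lef_pV2 ?posrE ?invr_gt0//.
    rewrite invf_div ler_pdivrMr// /s.
    have : (n%:R <= 6 + 2 * (size B)%:R :> R).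
      by rewrite -natrM -natrD ler_nat.
    lra.
  apply: (@le_trans _ _ (w u * (6 / n%:R) * (C * (4 * C ^+ 2 * \sum_j p j u ^+ 2)))).
    apply: ler_pM => //.
    - by rewrite divr_ge0// ltW.
    - by rewrite mulr_ge0// sumr_ge0// => k _; exact: sqr_ge0.
    - by rewrite ler_wpM2l.
    - by rewrite ler_wpM2l.
  rewrite le_eqVlt; apply/orP; left; apply/eqP.
  by rewrite /w /psi !invfM; ring.
have mpp0 : measurable_fun setT (fun y : n.-tuple T =>
    (psi (tnth y ord0) / p ord0 (tnth y ord0))%:E).
  exact: (measurable_coord ord0 mpp).
have C3 : (0 <= (24 * C ^+ 3)%:E)%E by rewrite lee_fin mulr_ge0// exprn_ge0.
rewrite ge0_integralZl//.
rewrite (integral_coord QG ord0 mpp pp0) integral_div_posterior//.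
rewrite (_ : 24 * C ^+ 4 = (24 * C ^+ 3) * C); last by ring.
by rewrite [leRHS]EFinM; exact: lee_wpmul2l.
Qed.

(** [D] is the coordinate 0 of a permutation invariant rule; by invariance,
    coordinate [i] of the rule is [D] evaluated at the sample in which 0 and [i]
    are exchanged, so the two sums are the risks of the simple posterior mean
    and of the rule. *)
Lemma posterior_mean_regret (D : n.-tuple T -> R) : measurable_fun setT D ->
  (\sum_i \int[Q]_y ((pm (tnth y i) - th i) ^+ 2)%:E <=
   \sum_i \int[Q]_y ((D (permute (tperm ord0 i) y) - th i) ^+ 2)%:E +
   (2 / Num.min gamma 1 * (48 * C ^+ 4))%:E)%E.
Proof.
move=> mD; set ga := Num.min gamma 1.
have ga0 : 0 < ga by rewrite lt_min gamma_gt0 ltr01.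
have ga1 : ga <= 1 by rewrite ge_min lexx orbT.
have gag : ga <= gamma by rewrite ge_min lexx.
(* [A] and [B] are the two halves of the indices other than 0. *)
pose s := [seq lift ord0 i | i <- enum 'I_m].
pose A := take m./2 s; pose B := drop m./2 s.
have ABs : A ++ B = s by exact: cat_take_drop.
have sE : ord0 :: A ++ B = enum 'I_n by rewrite ABs enum_ordSl.
have ss : size s = m by rewrite size_map size_enum_ord.
have sA : size A = m./2 by rewrite size_takel// ss; lia.
have sB : size B = (m - m./2)%N by rewrite size_drop ss.
have := enum_uniq 'I_n; rewrite -sE /= => /andP[AB0 uAB].
have uBA : uniq (B ++ A) by rewrite uniq_catC.
have BA0 : ord0 \notin B ++ A by rewrite mem_cat orbC -mem_cat.
have pAB : perm_eq (ord0 :: A ++ B) (index_enum 'I_n).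
  rewrite sE; apply: uniq_perm; [exact: enum_uniq|exact: index_enum_uniq|].
  by move=> i; rewrite mem_enum mem_index_enum.
pose term (A B : seq 'I_n) y := (p ord0 (tnth y ord0) * pmin (tnth y ord0))^-1 *
  ((\sum_(k <- A) b k (tnth y ord0) * Z k (tnth y k)) ^+ 2 /
   (1 + \sum_(k <- B) \1_(E k) (tnth y k))).
have term0 A' B' y : 0 <= term A' B' y.
  apply: mulr_ge0; first by rewrite invr_ge0 mulr_ge0.
  apply: divr_ge0; first exact: sqr_ge0.
  by apply: addr_ge0 => //; apply: sumr_ge0 => k _; rewrite indicE ler0n.
have mterm A' B' : measurable_fun setT (term A' B').
  apply: measurable_funM.
    apply: measurable_fun_invr; apply: measurable_funM.
      exact: (measurable_coord ord0 (mp ord0)).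
    exact: (measurable_coord ord0 mpmin).
  apply: measurable_funM.
    apply: measurable_funX; apply: measurable_sum => k; apply: measurable_funM.
      exact: (measurable_coord ord0 (mb k)).
    exact: (measurable_coord k (mZ k)).
  apply: measurable_fun_invr; apply: measurable_funD => //.
  apply: measurable_sum => k.
  apply: (measurable_coord k (g := \1_(E k) : T -> R)); exact: measurable_indic.
have sqe (x : R) : (0 <= (x ^+ 2)%:E)%E by rewrite lee_fin sqr_ge0.
have mpm0 i : measurable_fun setT (fun y : n.-tuple T =>
    ((pm (tnth y ord0) - th i) ^+ 2)%:E).
  apply/measurable_EFinP; apply: measurable_funX; apply: measurable_funB => //.
  exact: (measurable_coord ord0 mpm).
have mD2 i : measurable_fun setT (fun y : n.-tuple T => ((D y - th i) ^+ 2)%:E).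
  by apply/measurable_EFinP; apply: measurable_funX; exact: measurable_funB.
have mlame i : measurable_fun setT (fun y => (lam i y)%:E) by exact/measurable_EFinP.
have -> : (\sum_i \int[Q]_y ((pm (tnth y i) - th i) ^+ 2)%:E =
    \int[Q]_y \sum_i (((pm (tnth y ord0) - th i) ^+ 2)%:E * (lam i y)%:E))%E.
  rewrite ge0_integral_sum//; last 2 first.
  - by move=> i; exact: emeasurable_funM.
  - by move=> i y _; rewrite mule_ge0// lee_fin.
  apply: eq_bigr => i _.
  rewrite -(@integral_tperm_ord0 i (fun y => ((pm (tnth y ord0) - th i) ^+ 2)%:E))//.
  by apply: eq_integral => y _; rewrite tnth_mktuple tpermL.
have -> : (\sum_i \int[Q]_y ((D (permute (tperm ord0 i) y) - th i) ^+ 2)%:E =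
    \int[Q]_y \sum_i (((D y - th i) ^+ 2)%:E * (lam i y)%:E))%E.
  rewrite ge0_integral_sum//; last 2 first.
  - by move=> i; exact: emeasurable_funM.
  - by move=> i y _; rewrite mule_ge0// lee_fin.
  apply: eq_bigr => i _.
  exact: (@integral_tperm_ord0 i (fun y => ((D y - th i) ^+ 2)%:E)).
have msum (F : 'I_n -> n.-tuple T -> \bar R) :
    (forall i, measurable_fun setT (F i)) ->
    measurable_fun setT (fun y => \sum_i (F i y * (lam i y)%:E))%E.
  by move=> mF; apply: emeasurable_sum => i; exact: emeasurable_funM.
have sum0 (F : 'I_n -> R) y :
    (0 <= \sum_i ((F i ^+ 2)%:E * (lam i y)%:E))%E.
  by apply: sume_ge0 => i _; rewrite mule_ge0 // lee_fin.
have mAB : measurable_fun setT (fun y => (2 / ga * (term A B y + term B A y))%:E).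
  by apply/measurable_EFinP; apply: measurable_funM => //; exact: measurable_funD.
have AB_ge0 y : (0 <= (2 / ga * (term A B y + term B A y))%:E)%E.
  by rewrite lee_fin mulr_ge0 ?divr_ge0 ?(ltW ga0)// addr_ge0.
apply: (@le_trans _ _ (\int[Q]_y (\sum_i (((D y - th i) ^+ 2)%:E * (lam i y)%:E) +
    (2 / ga * (term A B y + term B A y))%:E))%E).
  apply: ae_ge0_le_integral => //.
  - exact: msum.
  - by move=> y _; apply: adde_ge0 => //; exact: sum0.
  - by apply: emeasurable_funD => //; exact: msum.
  apply: filterS ae_sample_density_gt0 => y yp _.
  have g0y j : 0 < g j (tnth y ord0) by exact: yp.
  have S0 : 0 < \sum_j g j (tnth y ord0).
    by rewrite (bigD1 ord0)//= ltr_wpDr// sumr_ge0.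
  have p0 i : 0 < p i (tnth y ord0) by rewrite divr_gt0.
  have [pmin0 pminp] := pmin_le g0y.
  pose l k := g ord0 (tnth y k) / g k (tnth y k).
  have l0 k : 0 < l k by rewrite divr_gt0//; exact: yp.
  have lamE i : lam i y = p i (tnth y ord0) / p ord0 (tnth y ord0) * l i.
    by rewrite /lam /p /l; field; rewrite !gt_eqF//; exact: yp.
  have W0 : 0 < \sum_i lam i y.
    rewrite (bigD1 ord0)//= ltr_wpDr ?sumr_ge0// lamE mulr_gt0// divr_gt0//.
  under eq_bigr do rewrite -EFinM mulrC.
  under [in leRHS]eq_bigr do rewrite -EFinM mulrC.
  rewrite !sumEFin -EFinD lee_fin.
  apply: (le_trans (weighted_sqr_le th (pm (tnth y ord0)) (D y) W0)).
  rewrite lerD2l.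
  under eq_bigr do rewrite lamE.
  rewrite [X in _ / X <= _](eq_bigr _ (fun i _ => lamE i)).
  rewrite /term -mulrDr.
  apply: (swap_weight_bound (c := fun k => \1_(E k) (tnth y k))
    pAB p0 _ _ pmin0 pminp ga0 ga1 l0) => //.
  - by rewrite -mulr_suml divff// gt_eqF.
  - by rewrite /l divff// gt_eqF.
  - move=> i; rewrite indicE; case: (boolP (_ \in _)) => [/set_mem Ei|_].
      by rewrite mulr1 (le_trans gag)// ltW.
    by rewrite mulr0 ltW.
rewrite ge0_integralD//; last exact: msum.
apply: leeD => //.
under eq_integral do rewrite EFinM EFinD.
rewrite ge0_integralZl//; last 3 first.
- by apply: emeasurable_funD; exact/measurable_EFinP.
- by move=> y _; rewrite -EFinD lee_fin addr_ge0.
- by rewrite lee_fin divr_ge0// ltW.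
rewrite [leRHS]EFinM; apply: lee_wpmul2l; first by rewrite lee_fin divr_ge0// ltW.
rewrite ge0_integralD//; last 4 first.
- by move=> y _; rewrite lee_fin.
- exact/measurable_EFinP.
- by move=> y _; rewrite lee_fin.
- exact/measurable_EFinP.
rewrite (_ : 48 * C ^+ 4 = 24 * C ^+ 4 + 24 * C ^+ 4); last by ring.
rewrite EFinD; apply: leeD; apply: half_sample_bound => //.
- by rewrite sB; lia.
- by rewrite sA; lia.
Qed.

End posterior_mean_regret.

(** * Rules and their risks *)

Lemma ereal_bigO1_bounded (R : realType) (u : nat -> \bar R) (K : R) :
  (forall n, (0 < n)%N -> (0 <= u n <= K%:E)%E) -> ereal_bigO1 u.
Proof.
move=> uK.
have ufin n : (0 < n)%N -> u n \is a fin_num.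
  by move=> /uK /andP[u0 uk]; rewrite ge0_fin_numE// (le_lt_trans uk) ?ltry.
split; first by exists 1%N => // n /= n0; exact: ufin.
apply/eqOP; exists K; split; first exact: num_real.
move=> k Kk; exists 1%N => // n /= n0.
have /andP[u0 uk] := uK _ n0.
rewrite normr1 mulr1 ger0_norm ?fine_ge0// (le_trans _ (ltW Kk))//.
by rewrite -lee_fin fineK// ufin.
Qed.

Section rules.
Context {d : measure_display} {T : measurableType d} {R : realType} {n : nat}.
Implicit Types D : n.-tuple T -> n.-tuple R.

Lemma permute_inj (S : Type) (s : 'S_n) : injective (@permute S n s).
Proof.
move=> a b ab; apply: eq_from_tnth => i.
have := congr1 (fun t => tnth t (s^-1 i)%g) ab.
by rewrite !tnth_mktuple permKV.
Qed.

Lemma permutation_invariantP D : permutation_invariant D <->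
  measurable_fun setT D /\ forall s y, D (permute s y) = permute s (D y).
Proof.
split=> -[mD Dp]; split=> //.
- by move=> s y; apply/(Dp s y (D y)).
- move=> s y t; rewrite Dp; split=> [->//|]; exact: permute_inj.
Qed.

(** Hence the best invariant rule is at least as good as the best simple one. *)
Lemma simple_symmetric_permutation_invariant D :
  simple_symmetric D -> permutation_invariant D.
Proof.
move=> [delta mdelta DE]; apply/permutation_invariantP; split.
  apply/measurable_fun_tnthP => i.
  rewrite (_ : _ \o _ = fun y => delta (tnth y i)).
    exact: (measurable_coord i mdelta).
  by apply/funext => y /=; rewrite DE tnth_map.
move=> s y; rewrite !DE; apply: eq_from_tnth => i.
by rewrite tnth_map !tnth_mktuple tnth_map.
Qed.

Definition midrule D1 D2 (y : n.-tuple T) : n.-tuple R :=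
  [tuple (tnth (D1 y) i + tnth (D2 y) i) / 2 | i < n].

Lemma midrule_permutation_invariant D1 D2 :
  permutation_invariant D1 -> permutation_invariant D2 ->
  permutation_invariant (midrule D1 D2).
Proof.
move=> /permutation_invariantP[m1 p1] /permutation_invariantP[m2 p2].
apply/permutation_invariantP; split.
  apply/measurable_fun_tnthP => i.
  rewrite (_ : _ \o _ = fun y => (tnth (D1 y) i + tnth (D2 y) i) / 2).
    have /measurable_fun_tnthP/(_ i) m1i := m1.
    have /measurable_fun_tnthP/(_ i) m2i := m2.
    by apply: measurable_funM => //; exact: measurable_funD.
  by apply/funext => y /=; rewrite tnth_mktuple.
by move=> s y; apply: eq_from_tnth => i; rewrite !tnth_mktuple p1 p2 !tnth_mktuple.
Qed.

Lemma sqdist_ge0 (a b : n.-tuple R) : 0 <= sqdist a b.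
Proof. by apply: sumr_ge0 => i _; exact: sqr_ge0. Qed.

(** The parallelogram identity. *)
Lemma sqdist_midrule D1 D2 y (c : n.-tuple R) :
  sqdist (D1 y) (D2 y) + 4 * sqdist (midrule D1 D2 y) c =
  2 * sqdist (D1 y) c + 2 * sqdist (D2 y) c.
Proof.
rewrite /sqdist !mulr_sumr -!big_split/=; apply: eq_bigr => i _.
by rewrite tnth_mktuple; field.
Qed.

Lemma measurable_sqdist D1 D2 :
  measurable_fun setT D1 -> measurable_fun setT D2 ->
  measurable_fun setT (fun y => (sqdist (D1 y) (D2 y))%:E).
Proof.
move=> /measurable_fun_tnthP m1 /measurable_fun_tnthP m2.
apply/measurable_EFinP; apply: measurable_sum => i.
by apply: measurable_funX; apply: measurable_funB; [exact: m1|exact: m2].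
Qed.

End rules.

(** * The minimal weight *)

Section min_weight.
Context {d : measure_display} {T : measurableType d} {R : realType}.
Variables (f : R -> T -> R) (mu : nat -> R) (m : nat).
Hypothesis mf : forall i, measurable_fun setT (f (mu i)).
Hypothesis f0 : forall i u, 0 <= f (mu i) u.

Lemma weight_ge0 j u : 0 <= weight f mu m.+1 j u.
Proof. by rewrite divr_ge0// sumr_ge0. Qed.

Lemma measurable_weight j : measurable_fun setT (weight f mu m.+1 j).
Proof.
by apply: measurable_funM => //; apply: measurable_fun_invr; exact: measurable_sum.
Qed.

Lemma min_weight_le j u : (j < m.+1)%N ->
  (min_weight f mu m.+1 u <= (weight f mu m.+1 j u)%:E)%E.
Proof.
by move=> jm; exact: (bigmin_le _ (Ordinal jm)).
Qed.

Lemma min_weight_ge0 u : (0 <= min_weight f mu m.+1 u)%E.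
Proof.
by apply: le_bigmin => [|i _]; rewrite ?leey// lee_fin weight_ge0.
Qed.

Lemma min_weight_fin_num u : min_weight f mu m.+1 u \is a fin_num.
Proof.
rewrite ge0_fin_numE ?min_weight_ge0//.
by rewrite (le_lt_trans (min_weight_le u (ltn0Sn m)))// ltry.
Qed.

Lemma measurable_min_weight : measurable_fun setT (min_weight f mu m.+1).
Proof.
rewrite /min_weight; elim: (index_enum _) => [|i s IH].
  by under eq_fun do rewrite big_nil; exact: measurable_cst.
under eq_fun do rewrite big_cons.
apply: measurable_mine => //; apply/measurable_EFinP; exact: measurable_weight.
Qed.

Lemma min_weight_gt0 u : (0 < min_weight f mu m.+1 u)%E <->
  forall j, (j < m.+1)%N -> 0 < f (mu j) u.
Proof.
split=> [m0 j jm|fp].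
  have := lt_le_trans m0 (min_weight_le u jm); rewrite lte_fin => w0.
  by rewrite lt0r f0 andbT; apply: contraTneq w0 => e; rewrite /weight e mul0r ltxx.
apply: lt_bigmin => [|i _]; first by rewrite ltry.
rewrite lte_fin divr_gt0 ?fp//.
by rewrite (bigD1 i)//= ltr_wpDr ?fp// sumr_ge0.
Qed.

End min_weight.

(** * The law of the sample *)

Section sample.
Context {d : measure_display} {T : measurableType d} {R : realType}.
Context {d0 : measure_display} {Omega : measurableType d0}.
Variables (P : probability Omega R) (Y : nat -> {RV P >-> T}).
Variable L : nat -> probability T R.
Hypothesis hY : mutually_independent Y.
Hypothesis hYL : forall i A, measurable A -> P (Y i @^-1` A) = L i A.

Lemma integral_observation i (phi : T -> \bar R) :
  measurable_fun setT phi -> (forall u, 0 <= phi u)%E ->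
  (\int[P]_w phi (Y i w) = \int[L i]_u phi u)%E.
Proof.
move=> mphi phi0; rewrite -(ge0_integral_distribution (Y i))//.
by apply: eq_measure_integral => A mA _; exact: hYL.
Qed.

Lemma exists_product_law n : exists2 Q : probability (n.-tuple T) R,
  product_law Q (fun i => L i) &
  forall h : n.-tuple T -> \bar R,
    measurable_fun setT h -> (forall y, 0 <= h y)%E ->
    (\int[P]_w h (prefix_tuple (fun i => Y i w) n) = \int[Q]_y h y)%E.
Proof.
have mX : measurable_fun setT (fun w => prefix_tuple (fun i => Y i w) n).
  apply/measurable_fun_tnthP => i.
  rewrite (_ : _ \o _ = Y i); first exact: measurable_funP.
  by apply/funext => w /=; rewrite tnth_mktuple.
pose X_mixin := isMeasurableFun.Build _ _ _ _ _ mX.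
pose X : {mfun Omega >-> n.-tuple T} :=
  HB.pack (fun w => prefix_tuple (fun i => Y i w) n) X_mixin.
exists (distribution P X) => [A mA|h mh h0]; last first.
  by rewrite ge0_integral_distribution.
pose A' k : set T := if insub k is Some i then A i else setT.
have mA' k : measurable (A' k) by rewrite /A'; case: insubP.
have A'E (i : 'I_n) : A' i = A i by rewrite /A' valK.
transitivity (P (\bigcap_(i in [set` iota 0 n]) (Y i @^-1` A' i))).
  rewrite -[LHS]/(P (X @^-1` box A)); congr (P _).
  apply/seteqP; split=> w /=.
    move=> XA k /=; rewrite mem_iota/= add0n => kn.
    by have := XA (Ordinal kn); rewrite tnth_mktuple -A'E.
  move=> YA i; rewrite tnth_mktuple -A'E; apply: YA.
  by rewrite /= mem_iota/= add0n.
rewrite hY ?iota_uniq// -[n in iota 0 n]subn0 -/(index_iota 0 n) big_mkord.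
by apply: eq_bigr => i _; rewrite hYL// A'E.
Qed.

End sample.

(** * Comparison of the two risks *)

Section compound_decision_risk.
Context {d : measure_display} {T : measurableType d} {R : realType}.
Variable nu : {measure set T -> \bar R}.
Variables (F : R -> probability T R) (f : R -> T -> R) (mu : nat -> R).
Hypothesis hf : forall i, is_density nu (F (mu i)) (f (mu i)).
Context {d0 : measure_display} {Omega : measurableType d0}.
Variables (P : probability Omega R) (Y : nat -> {RV P >-> T}).
Hypothesis hY : mutually_independent Y.
Hypothesis hYF : forall i A, measurable A -> P (Y i @^-1` A) = F (mu i) A.

Let mf i : measurable_fun setT (f (mu i)). Proof. by have [] := hf i. Qed.
Let f0 i u : 0 <= f (mu i) u. Proof. by have [] := hf i. Qed.

Let measurable_sample n (D : n.-tuple T -> n.-tuple R) :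
  measurable_fun setT D ->
  measurable_fun setT (fun w => D (prefix_tuple (fun i => Y i w) n)).
Proof.
move=> mD; apply: (measurableT_comp mD).
apply/measurable_fun_tnthP => i.
rewrite (_ : _ \o _ = Y i); first exact: measurable_funP.
by apply/funext => w /=; rewrite tnth_mktuple.
Qed.

Lemma risk_ge0 n (D : n.-tuple T -> n.-tuple R) : (0 <= risk Y mu D)%E.
Proof.
rewrite /risk unlock; apply: integral_ge0 => w _; rewrite lee_fin.
exact: sqdist_ge0.
Qed.

(** The zero rule is simple symmetric, and its finite risk bounds the risks of
    all best rules. *)
Lemma risk_cst0 n :
  risk Y mu (fun _ : n.-tuple T => [tuple 0 | i < n]) =
  (\sum_(i < n) mu i ^+ 2)%:E.
Proof.
rewrite /risk unlock; transitivity (\int[P]_w (\sum_(i < n) mu i ^+ 2)%:E)%E.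
  apply: eq_integral => w _; congr (_%:E); apply: eq_bigr => i _.
  by rewrite !tnth_mktuple sub0r sqrrN.
exact: integral_probability_cst.
Qed.

(** The midpoint of the two rules is invariant, so its risk is at least [b]; the
    parallelogram identity does the rest. *)
Lemma expected_sqdist_le_risk_gap n (DS DPI : n.-tuple T -> n.-tuple R) (a b : R) :
  permutation_invariant DS ->
  best_rule Y mu (@permutation_invariant d T R n) DPI ->
  risk Y mu DS = a%:E -> risk Y mu DPI = b%:E ->
  ('E_P[fun w => sqdist (DS (prefix_tuple (fun i => Y i w) n))
                        (DPI (prefix_tuple (fun i => Y i w) n))]
    <= (2 * (a - b))%:E)%E.
Proof.
move=> DSpi [DPIpi DPImin] DSa DPIb.
have midpi := midrule_permutation_invariant DSpi DPIpi.
have := DPImin _ midpi; rewrite DPIb; move: DSa DPIb.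
rewrite /risk unlock => DSa DPIb midb.
pose S w := DS (prefix_tuple (fun i => Y i w) n).
pose X w := DPI (prefix_tuple (fun i => Y i w) n).
pose M w := midrule DS DPI (prefix_tuple (fun i => Y i w) n).
pose c : n.-tuple R := prefix_tuple mu n.
have mS : measurable_fun setT S by apply: measurable_sample; exact: DSpi.1.
have mX : measurable_fun setT X by apply: measurable_sample; exact: DPIpi.1.
have mM : measurable_fun setT M by apply: measurable_sample; exact: midpi.1.
have mc : measurable_fun setT (fun _ : Omega => c) by exact: measurable_cst.
have nn (x y : Omega -> n.-tuple R) w : (0 <= (sqdist (x w) (y w))%:E)%E.
  by rewrite lee_fin sqdist_ge0.
have msq (x y : Omega -> n.-tuple R) : measurable_fun setT x ->
    measurable_fun setT y -> measurable_fun setT (fun w => (sqdist (x w) (y w))%:E).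
  move=> /measurable_fun_tnthP mx /measurable_fun_tnthP my.
  apply/measurable_EFinP; apply: measurable_sum => i.
  by apply: measurable_funX; apply: measurable_funB; [exact: mx|exact: my].
have e : (\int[P]_w (sqdist (S w) (X w))%:E +
    4%:E * \int[P]_w (sqdist (M w) c)%:E = (2 * a + 2 * b)%:E)%E.
  transitivity (2%:E * \int[P]_w (sqdist (S w) c)%:E +
      2%:E * \int[P]_w (sqdist (X w) c)%:E)%E; last first.
    by rewrite DSa DPIb.
  have ZE (k : R) (x y : Omega -> n.-tuple R) : 0 <= k ->
      measurable_fun setT x -> measurable_fun setT y ->
      (k%:E * \int[P]_w (sqdist (x w) (y w))%:E =
       \int[P]_w (k * sqdist (x w) (y w))%:E)%E.
    move=> k0 mx my; under [RHS]eq_integral do rewrite EFinM.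
    rewrite ge0_integralZl ?lee_fin//; exact: msq.
  have mk (k : R) (x y : Omega -> n.-tuple R) : measurable_fun setT x ->
      measurable_fun setT y ->
      measurable_fun setT (fun w => (k * sqdist (x w) (y w))%:E).
    move=> mx my; apply/measurable_EFinP; apply: measurable_funM => //.
    by apply/measurable_EFinP; exact: msq.
  have kn (k : R) (x y : Omega -> n.-tuple R) w : 0 <= k ->
      (0 <= (k * sqdist (x w) (y w))%:E)%E.
    by move=> k0; rewrite lee_fin mulr_ge0// sqdist_ge0.
  rewrite (ZE 4 M (fun=> c))// (ZE 2 S (fun=> c))// (ZE 2 X (fun=> c))//.
  rewrite -ge0_integralD//; first last.
  - exact: (mk 4 M (fun=> c)).
  - by move=> w _; exact: (kn 4 M (fun=> c)).
  - exact: msq.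
  rewrite -ge0_integralD//; first last.
  - exact: (mk 2 X (fun=> c)).
  - by move=> w _; exact: (kn 2 X (fun=> c)).
  - exact: (mk 2 S (fun=> c)).
  - by move=> w _; exact: (kn 2 S (fun=> c)).
  apply: eq_integral => w _; rewrite -!EFinD; congr (_%:E).
  exact: sqdist_midrule.
have h : (4%:E * b%:E <= 4%:E * \int[P]_w (sqdist (M w) c)%:E)%E by exact: lee_wpmul2l.
rewrite -(@leeD2rE _ (4%:E * b%:E))//.
apply: (@le_trans _ _ (2 * a + 2 * b)%:E).
  by rewrite -e; apply: leeD.
by rewrite -EFinM -EFinD lee_fin; lra.
Qed.

Section regret.
Variables (C gamma : R) (m : nat).
Hypothesis gamma_gt0 : 0 < gamma.
Hypothesis hG1 : G1 F f mu C gamma m.+1.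
Hypothesis hG2 : G2 Y f mu C m.+1.
Local Notation n := m.+1.

Let wt j u := weight f mu n j u.
Let mwt j : measurable_fun setT (wt j).
Proof. exact: (measurable_weight m mf). Qed.

Let minw u : R := fine (min_weight f mu n u).

Let minwE u : min_weight f mu n u = (minw u)%:E.
Proof. by rewrite fineK// min_weight_fin_num. Qed.

Let mminw : measurable_fun setT minw.
Proof.
have mm := measurable_min_weight m mf.
exact: (measurableT_comp (fine_measurable measurableT) mm).
Qed.

Let minw_ge0 u : 0 <= minw u.
Proof. by rewrite fine_ge0// min_weight_ge0. Qed.

Let inv_minw u : \bar R := ((n%:R)%:E * min_weight f mu n u)^-1%E.

Let inv_minw_ge0 u : (0 <= inv_minw u)%E.
Proof. by rewrite inve_ge0 mule_ge0 ?lee_fin// min_weight_ge0. Qed.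

Let inv_minwE u :
  inv_minw u = if minw u == 0 then +oo%E else ((n%:R * minw u)^-1)%:E.
Proof. by rewrite /inv_minw minwE -EFinM inver mulf_eq0 pnatr_eq0. Qed.

Let measurable_inv_minw : measurable_fun setT inv_minw.
Proof.
rewrite (_ : inv_minw = fun u => if minw u == 0 then +oo%E else ((n%:R * minw u)^-1)%:E).
  apply: measurable_fun_ifT => //.
    apply: (measurable_fun_bool true).
    rewrite setTI (_ : _ @^-1` _ = minw @^-1` [set 0]).
      by rewrite -[X in measurable X]setTI; exact: mminw.
    by apply/seteqP; split => u /= /eqP.
  apply/measurable_EFinP; apply: measurable_fun_invr.
  exact: measurable_funM.
by apply/funext => u; exact: inv_minwE.
Qed.

(** The second bound of [G2] makes 1 / min_j p_j(Y_i) almost surely finite, so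
    every density of the family is positive at every observation. *)
Lemma ae_density_gt0 (i : 'I_n) :
  {ae F (mu i), forall u, forall j : 'I_n, 0 < f (mu j) u}.
Proof.
have [_ h _] := hG2.
have inty : (\int[F (mu i)]_u inv_minw u < +oo)%E.
  rewrite -(integral_observation hYF i measurable_inv_minw)//.
  apply: le_lt_trans (_ : C%:E * n%:R%:E < +oo)%E; last by rewrite -EFinM ltry.
  apply: le_trans (ltW h).
  rewrite (bigD1 i)//= leeDl// sume_ge0// => k _; apply: integral_ge0 => w _.
  exact: inv_minw_ge0.
have ii : (F (mu i)).-integrable setT inv_minw.
  apply/integrableP; split=> //.
  by under eq_integral do rewrite gee0_abs//.
apply: filterS (integrable_ae measurableT ii) => u /(_ Logic.I).
rewrite inv_minwE; case: eqP => // /eqP w0 _ j.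
have : (0 < min_weight f mu n u)%E by rewrite minwE lte_fin lt0r w0/=.
by move/min_weight_gt0; apply.
Qed.

Definition posterior_mean (u : T) : R := \sum_(i < n) mu i * wt i u.

(** The third bound of [G2] is the hypothesis on p_j^2 / (n min_j p_j) of
    [posterior_mean_regret], up to exchanging sum and integral. *)
Lemma posterior_mean_risk_le (D : n.-tuple T -> n.-tuple R) :
  permutation_invariant D ->
  (risk Y mu (map_tuple posterior_mean : n.-tuple T -> n.-tuple R) <=
   risk Y mu D + (2 / Num.min gamma 1 * (48 * C ^+ 4))%:E)%E.
Proof.
move=> /permutation_invariantP[mD Dp].
have [Q QG QE] := exists_product_law hY hYF n.
have [muC ratio2 half] := hG1.
have mpm : measurable_fun setT posterior_mean.
  by apply: measurable_sum => i; apply: measurable_funM => //; exact: mwt.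
have riskE (D' : n.-tuple T -> n.-tuple R) : measurable_fun setT D' ->
    risk Y mu D' = (\sum_(i < n) \int[Q]_y ((tnth (D' y) i - mu i) ^+ 2)%:E)%E.
  move=> mD'; rewrite /risk unlock.
  rewrite (QE (fun y => (sqdist (D' y) (prefix_tuple mu n))%:E)); last 2 first.
  - by apply: measurable_sqdist => //; exact: measurable_cst.
  - by move=> y; rewrite lee_fin sqdist_ge0.
  have /measurable_fun_tnthP mDi := mD'.
  rewrite -ge0_integral_sum//; last 2 first.
  - move=> i; apply/measurable_EFinP; apply: measurable_funX.
    by apply: measurable_funB => //; exact: mDi.
  - by move=> i y _; rewrite lee_fin sqr_ge0.
  apply: eq_integral => y _; rewrite sumEFin; congr (_%:E).
  by apply: eq_bigr => i _; rewrite tnth_mktuple.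
have mpmt : measurable_fun setT (map_tuple posterior_mean : n.-tuple T -> n.-tuple R).
  apply/measurable_fun_tnthP => i.
  rewrite (_ : _ \o _ = fun y => posterior_mean (tnth y i)).
    exact: (measurable_coord i mpm).
  by apply/funext => y /=; rewrite tnth_map.
rewrite !riskE//.
have mD0 : measurable_fun setT (fun y => tnth (D y) ord0).
  by have /measurable_fun_tnthP/(_ ord0) := mD.
have := @posterior_mean_regret _ _ _ _ nu (fun i => F (mu i)) (fun i => f (mu i))
  (fun i => mu i) Q minw C gamma QG _ ae_density_gt0 _ _ gamma_gt0 _ mminw minw_ge0
  _ _ (fun y => tnth (D y) ord0) mD0.
have -> : (\sum_(i < n) \int[Q]_y
    ((tnth (map_tuple posterior_mean y) i - mu i) ^+ 2)%:E =
  \sum_(i < n) \int[Q]_y ((posterior_mean (tnth y i) - mu i) ^+ 2)%:E)%E.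
  by apply: eq_bigr => i _; apply: eq_integral => y _; rewrite tnth_map.
have -> : (\sum_(i < n) \int[Q]_y ((tnth (D y) i - mu i) ^+ 2)%:E =
  \sum_(i < n) \int[Q]_y
    ((tnth (D (permute (tperm ord0 i) y)) ord0 - mu i) ^+ 2)%:E)%E.
  apply: eq_bigr => i _; apply: eq_integral => y _.
  by rewrite Dp tnth_mktuple tpermL.
apply.
- by move=> i; exact: hf.
- by move=> i; rewrite ltW// muC.
- by move=> i j; have := ratio2 i j (ltn_ord i) (ltn_ord j); rewrite unlock => /ltW.
- by move=> i j; exact: half.
- move=> u fu; have mp : (0 < min_weight f mu n u)%E.
    by apply/min_weight_gt0 => // j jn; exact: (fu (Ordinal jn)).
  split; first by move: mp; rewrite minwE lte_fin.
  by move=> j; have := min_weight_le f mu u (ltn_ord j); rewrite minwE lee_fin.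
have [_ _ h] := hG2; apply: le_trans (ltW h).
pose psi u : \bar R := ((\sum_(j < n) wt j u ^+ 2)%:E * inv_minw u)%E.
have psi0 u : (0 <= psi u)%E.
  by rewrite mule_ge0// lee_fin sumr_ge0// => j _; exact: sqr_ge0.
have mwt2 : measurable_fun setT (fun u => (\sum_(j < n) wt j u ^+ 2)%:E).
  apply/measurable_EFinP; apply: measurable_sum => j; apply: measurable_funX.
  exact: mwt.
have mpsi : measurable_fun setT psi by exact: emeasurable_funM.
rewrite (_ : (\int[P]_w _ = \sum_(i < n) \int[P]_w psi (Y i w))%E); last first.
  rewrite -ge0_integral_sum// => i; apply: (measurableT_comp mpsi).
  exact: measurable_funP.
apply: lee_sum => i _.
rewrite (integral_observation hYF i mpsi psi0); apply: ge0_le_integral => //.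
- move=> u _; rewrite lee_fin divr_ge0 ?mulr_ge0// sumr_ge0// => j _.
  exact: sqr_ge0.
- apply/measurable_EFinP; apply: measurable_funM.
    by apply: measurable_sum => j; apply: measurable_funX; exact: mwt.
  by apply: measurable_fun_invr; exact: measurable_funM.
move=> u _; rewrite EFinM; apply: lee_wpmul2l.
  by rewrite lee_fin sumr_ge0// => j _; exact: sqr_ge0.
by rewrite inv_minwE; case: ifP => // _; rewrite leey.
Qed.

End regret.
End compound_decision_risk.

(** * The theorem *)

Theorem theorem5p1 (R : realType)
    (d : measure_display) (T : measurableType d)
    (nu : {measure set T -> \bar R})
    (M : set R) (F : R -> probability T R) (f : R -> T -> R)
    (hf : forall m, M m -> is_density nu (F m) (f m))
    (mu : nat -> R) (hmu : forall i, M (mu i))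
    (d0 : measure_display) (Omega : measurableType d0)
    (P : probability Omega R) (Y : nat -> {RV P >-> T})
    (hY : mutually_independent Y)
    (hYF : forall i A, measurable A -> P (Y i @^-1` A) = F (mu i) A)
    (C gamma : R) (hgamma : 0 < gamma)
    (hG1 : forall n, (0 < n)%N -> G1 F f mu C gamma n)
    (hG2 : forall n, (0 < n)%N -> G2 Y f mu C n)
    (DeltaS DeltaPI : forall n, n.-tuple T -> n.-tuple R)
    (hS : forall n, (0 < n)%N ->
      best_rule Y mu (@simple_symmetric d T R n) (@DeltaS n))
    (hPI : forall n, (0 < n)%N ->
      best_rule Y mu (@permutation_invariant d T R n) (@DeltaPI n)) :
  ereal_bigO1 (fun n =>
    'E_P[fun w => sqdist (DeltaS n (prefix_tuple (fun i => Y i w) n))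
                         (DeltaPI n (prefix_tuple (fun i => Y i w) n))]%E) /\
  ereal_bigO1 (fun n =>
    (risk Y mu (@DeltaS n) - risk Y mu (@DeltaPI n))%E).
Proof.
have hfmu i : is_density nu (F (mu i)) (f (mu i)) by exact: hf.
pose K := 2 / Num.min gamma 1 * (48 * C ^+ 4).
have risks n : (0 < n)%N -> exists a b : R,
    [/\ risk Y mu (@DeltaS n) = a%:E, risk Y mu (@DeltaPI n) = b%:E,
        b <= a & a <= b + K].
  case: n => // m n0.
  have [Ssym Smin] := hS _ n0; have [PIpi PImin] := hPI _ n0.
  have S_PI : (risk Y mu (@DeltaPI m.+1) <= risk Y mu (@DeltaS m.+1))%E.
    by apply: PImin; exact: simple_symmetric_permutation_invariant.
  have Sfin : (risk Y mu (@DeltaS m.+1) < +oo)%E.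
    apply: (@le_lt_trans _ _ (\sum_(i < m.+1) mu i ^+ 2)%:E); last exact: ltry.
    rewrite -(risk_cst0 (T := T) mu Y); apply: Smin; exists (cst 0) => // y.
    by apply: eq_from_tnth => i; rewrite tnth_mktuple tnth_map.
  have Sf : risk Y mu (@DeltaS m.+1) \is a fin_num.
    by rewrite ge0_fin_numE// risk_ge0.
  have PIf : risk Y mu (@DeltaPI m.+1) \is a fin_num.
    by rewrite ge0_fin_numE ?risk_ge0// (le_lt_trans S_PI).
  exists (fine (risk Y mu (@DeltaS m.+1))), (fine (risk Y mu (@DeltaPI m.+1))).
  rewrite !fineK//; split=> //; first exact: fine_le.
  rewrite -lee_fin EFinD !fineK//.
  apply: le_trans (posterior_mean_risk_le hfmu hY hYF hgamma (hG1 _ n0) (hG2 _ n0) PIpi).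
  apply: Smin; exists (posterior_mean f mu m) => //.
  apply: measurable_sum => i; apply: measurable_funM => //.
  by apply: measurable_weight => j; have [] := hfmu j.
split.
- apply: (@ereal_bigO1_bounded _ _ (2 * K)) => n n0.
  have [a [b [Sa PIb _ aK]]] := risks n n0.
  apply/andP; split.
    by rewrite unlock; apply: integral_ge0 => w _; rewrite lee_fin sqdist_ge0.
  have [Ssym _] := hS _ n0.
  apply: (le_trans (expected_sqdist_le_risk_gap
    (simple_symmetric_permutation_invariant Ssym) (hPI _ n0) Sa PIb)).
  by rewrite lee_fin; lra.
- apply: (@ereal_bigO1_bounded _ _ K) => n n0.
  have [a [b [-> -> ba aK]]] := risks n n0.
  by rewrite -EFinB !lee_fin; apply/andP; split; lra.
Qed.
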